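(* Assume the setting below. Then for any real $p\ge2$, any even integer $n\ge2$, any $\alpha\in(0,\alpha_{p(1+\log d),\infty})$ and any $\theta_0\in\mathbb R^d$, $$(n/2)^{1/2}\,\mathbb E^{1/p}\bigl[\|\bar{\mathbf A}(\bar\theta_n-\theta^\star)\|^p\bigr]\le C_{\mathrm{Rm},1}\{\operatorname{Tr}\Sigma_\varepsilon\}^{1/2}p^{1/2}+\Delta^{(\mathrm{fl})}_{n,p,\alpha}\|\varepsilon\|_\infty+e^{-\alpha an/8}\Delta^{(\mathrm{tr})}_{n,p,\alpha}\|\theta_0-\theta^\star\|,$$ where $C_{\mathrm{Rm},1}=60e$, $C_{\mathrm{Rm},2}=60$, $$\Delta^{(\mathrm{fl})}_{n,p,\alpha}=\frac{4e^{1/p}\mathsf D_2(ap)^{1/2}}{(\alpha n)^{1/2}}+e^{1/p}C_A(\mathsf D_3+\mathsf D_4)\alpha a p^{5/2}+\frac{2C_{\mathrm{Rm},2}\,p}{n^{1/2}}+C_A\mathsf D_1(\alpha a)^{1/2}p^{3/2},$$ $$\Delta^{(\mathrm{tr})}_{n,p,\alpha}=e^{1/p}\kappa_Q^{1/2}\bigl(4/(\alpha n^{1/2})+2^{-1/2}n^{1/2}C_A\bigr),$$ and $\mathsf D_1=\sqrt{2\kappa_Q}/a$, $\mathsf D_2=(2\kappa_Q)^{1/2}a^{-1}(1+4\kappa_Q^{1/2}C_Aa^{-1})$, $\mathsf D_3=2\kappa_QC_A/a^2$, $\mathsf D_4=4\kappa_Q^{1/2}C_A\mathsf D_3/a$.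
   Context: Setting: $d\ge1$; $(\mathsf Z,\mathcal Z)$ is a measurable space with a probability measure $\pi$; $\mathbf A:\mathsf Z\to\mathbb R^{d\times d}$ and $\mathbf b:\mathsf Z\to\mathbb R^d$ are measurable, $\bar{\mathbf A}=\int\mathbf A\,d\pi$, $\bar{\mathbf b}=\int\mathbf b\,d\pi$. $\|\cdot\|$ denotes the Euclidean norm on vectors and the spectral norm on matrices. Assume $-\bar{\mathbf A}$ is Hurwitz (every eigenvalue of $\bar{\mathbf A}$ has positive real part) and $C_A:=\sup_{z}\|\mathbf A(z)\|\vee\sup_z\|\tilde{\mathbf A}(z)\|<\infty$, where $\tilde{\mathbf A}(z)=\mathbf A(z)-\bar{\mathbf A}$. Let $\theta^\star=\bar{\mathbf A}^{-1}\bar{\mathbf b}$, $\tilde{\mathbf b}(z)=\mathbf b(z)-\bar{\mathbf b}$, $\varepsilon(z)=\tilde{\mathbf A}(z)\theta^\star-\tilde{\mathbf b}(z)$, and assume $\|\varepsilon\|_\infty:=\sup_z\|\varepsilon(z)\|<\infty$; $\Sigma_\varepsilon=\int\varepsilon(z)\varepsilon(z)^\top\,\pi(dz)$. Let $Q$ be the unique symmetric positive definite matrix with $\bar{\mathbf A}^\top Q+Q\bar{\mathbf A}=\mathrm I$; $\|x\|_Q=(x^\top Qx)^{1/2}$, $\|B\|_Q=\max_{\|x\|_Q=1}\|Bx\|_Q$; $\kappa_Q=\lambda_{\max}(Q)/\lambda_{\min}(Q)$; $a=1/(2\|Q\|)$; $\alpha_\infty=\min\{1/(2\|\bar{\mathbf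 A}\|_Q^2\|Q\|),\ \|Q\|\}$; $b_Q=2\sqrt{\kappa_Q}C_A$; for $q\ge2$, $\alpha_{q,\infty}=\min\{\alpha_\infty,\ a/(2b_Q^2q)\}$; $\log$ is the natural logarithm. $Z_1,Z_2,\dots$ are i.i.d. $\mathsf Z$-valued random variables with distribution $\pi$. Given $\theta_0\in\mathbb R^d$ and a step size $\alpha>0$, the LSA iterates are $\theta_k=\theta_{k-1}-\alpha\{\mathbf A(Z_k)\theta_{k-1}-\mathbf b(Z_k)\}$, $k\ge1$, and for even $n$ the Polyak–Ruppert average is $\bar\theta_n=(2/n)\sum_{k=n/2}^{n-1}\theta_k$. *)

(* Defs.v *)
From HB Require Import structures.
From mathcomp Require Import all_boot all_order all_algebra.
From mathcomp Require Import all_classical all_reals all_analysis.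
From mathcomp Require Import complex.
Set Implicit Arguments. Unset Strict Implicit. Unset Printing Implicit Defensive.
Import Order.TTheory GRing.Theory Num.Theory.
Local Open Scope classical_set_scope.
Local Open Scope ring_scope.

Section Defs.
Variable R : realType.

Definition vnorm d (v : 'cV[R]_d) : R := Num.sqrt (\sum_i (v i 0) ^+ 2).

Definition opnorm d (B : 'M[R]_d) : R :=
  sup [set vnorm (B *m x) | x in [set x : 'cV[R]_d | vnorm x = 1]].

Definition Qnorm d (Q : 'M[R]_d) (x : 'cV[R]_d) : R :=
  Num.sqrt ((x^T *m Q *m x) 0 0).

Definition Qopnorm d (Q B : 'M[R]_d) : R :=
  sup [set Qnorm Q (B *m x) | x in [set x : 'cV[R]_d | Qnorm Q x = 1]].

Definition lambda_max d (Q : 'M[R]_d) : R := sup [set a : R | eigenvalue Q a].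
Definition lambda_min d (Q : 'M[R]_d) : R := inf [set a : R | eigenvalue Q a].

Definition kappaQ d (Q : 'M[R]_d) : R := lambda_max Q / lambda_min Q.

Definition neg_hurwitz d (M : 'M[R]_d) : Prop :=
  forall z : R[i], eigenvalue (map_mx (fun x : R => (x%:C)%C) M) z ->
    0 < complex.Re z.

Definition symmetric_mx d (Q : 'M[R]_d) : Prop := Q^T = Q.
Definition posdef_mx d (Q : 'M[R]_d) : Prop :=
  forall x : 'cV[R]_d, x != 0 -> 0 < (x^T *m Q *m x) 0 0.

Definition mat_mean dZ (Zt : measurableType dZ) (pi : probability Zt R) d
  (A : Zt -> 'M[R]_d) : 'M[R]_d := \matrix_(i, j) (\int[pi]_z (A z i j)).
Definition vec_mean dZ (Zt : measurableType dZ) (pi : probability Zt R) d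
  (b : Zt -> 'cV[R]_d) : 'cV[R]_d := \col_i (\int[pi]_z (b z i 0)).

Definition cov_mean dZ (Zt : measurableType dZ) (pi : probability Zt R) d
  (e : Zt -> 'cV[R]_d) : 'M[R]_d := \matrix_(i, j) (\int[pi]_z (e z i 0 * e z j 0)).

(* Z_1, Z_2, ... (index 0 unused) are mutually independent, each with law pi *)
Definition iid_seq dZ (Zt : measurableType dZ) (pi : probability Zt R)
  dO (Om : measurableType dO) (P : probability Om R) (Z : nat -> Om -> Zt) : Prop :=
  (forall k, (0 < k)%N -> measurable_fun setT (Z k)) /\
  (forall k, (0 < k)%N -> forall B : set Zt, measurable B ->
      P (Z k @^-1` B) = pi B) /\
  (forall I : seq nat, uniq I -> all (fun k => 0 < k)%N I ->
   forall B : nat -> set Zt, (forall k, measurable (B k)) ->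
     P (\bigcap_(k in [set k | k \in I]) (Z k @^-1` B k)) =
     (\prod_(k <- I) P (Z k @^-1` B k))%E).

Fixpoint lsa dZ (Zt : measurableType dZ) Om d (A : Zt -> 'M[R]_d) (b : Zt -> 'cV[R]_d)
  (Z : nat -> Om -> Zt) (alpha : R) (th0 : 'cV[R]_d) (k : nat) (w : Om) : 'cV[R]_d :=
  match k with
  | 0 => th0
  | k'.+1 => let t := lsa A b Z alpha th0 k' w in
             t - alpha *: (A (Z k'.+1 w) *m t - b (Z k'.+1 w))
  end.

Definition pr_avg dZ (Zt : measurableType dZ) Om d (A : Zt -> 'M[R]_d)
  (b : Zt -> 'cV[R]_d) (Z : nat -> Om -> Zt) (alpha : R) (th0 : 'cV[R]_d)
  (n : nat) (w : Om) : 'cV[R]_d :=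
  (2 / n%:R) *: \sum_(n./2 <= k < n) lsa A b Z alpha th0 k w.

Definition C_Rm1 : R := 60 * expR 1.
Definition C_Rm2 : R := 60.

Definition D1 (kappa a : R) : R := Num.sqrt (2 * kappa) / a.
Definition D2 (kappa a CA : R) : R :=
  (2 * kappa) `^ (1/2) / a * (1 + 4 * kappa `^ (1/2) * CA / a).
Definition D3 (kappa a CA : R) : R := 2 * kappa * CA / a ^+ 2.
Definition D4 (kappa a CA : R) : R := 4 * kappa `^ (1/2) * CA * D3 kappa a CA / a.

Definition Delta_fl (kappa a CA : R) (n : nat) (p alpha : R) : R :=
  4 * expR (1 / p) * D2 kappa a CA * (a * p) `^ (1/2) / (alpha * n%:R) `^ (1/2)
  + expR (1 / p) * CA * (D3 kappa a CA + D4 kappa a CA) * alpha * a * p `^ (5/2)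
  + 2 * C_Rm2 * p / n%:R `^ (1/2)
  + CA * D1 kappa a * (alpha * a) `^ (1/2) * p `^ (3/2).

Definition Delta_tr (kappa CA : R) (n : nat) (p alpha : R) : R :=
  expR (1 / p) * kappa `^ (1/2) *
  (4 / (alpha * n%:R `^ (1/2)) + 2 `^ (- (1/2)) * n%:R `^ (1/2) * CA).

End Defs.

(* Main.v *)
Require Import Defs.
From HB Require Import structures.
From mathcomp Require Import all_boot all_order all_algebra.
From mathcomp Require Import all_classical all_reals all_analysis.
From mathcomp Require Import complex.
From mathcomp Require Import measurable_realfun zify ring lra.

(** Subtracting the fixed point splits theta_k - thstar into tr_k + fl_k, where tr is the
    noiseless recursion started at theta_0 - thstar and fl is driven by eps from 0. Summing the
    recursion over the averaging window expresses Abar (thetabar_n - thstar) through boundary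
    terms, the martingale sum of (A(Z_{k+1}) - Abar) fl_k, the i.i.d. sum of eps(Z_{k+1}), and a
    transient remainder; Minkowski's inequality combines their L^p norms.

    For both recursions the moment of order p/2 of the joint energy B + |M_k|^2 + g |x_k|_Q^2 of
    the martingale M and the state x is propagated one step at a time, for all B, g >= 0 at once.
    With c the centred cross term of the energy, the two-point inequality
    (S + 2 c + T)^(p/2) <= (S + K T)^(p/2) + beta c, valid when c^2 <= S T, shows that
    integrating out the fresh sample costs only a constant K <= 4 p / 3. The i.i.d. sum is handled
    likewise through the energy B + |S_k|^2 with B >= p^2 sup|eps|^2, which makes every increment
    small relative to the energy. *)

Set Implicit Arguments.
Unset Strict Implicit.
Unset Printing Implicit Defensive.
Import Order.TTheory GRing.Theory Num.Theory.
Local Open Scope classical_set_scope.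
Local Open Scope ring_scope.

(** * Scalar convexity estimates and the two-point moment inequality *)

Section ScalarInequalities.
Context {R : realType}.
Implicit Types x y r s t c v : R.

(** Unrolled, [fl] contains products of random matrices. The joint energy avoids them: a martingale
    increment has square norm at most [CA ^+ 2] times that of the state, so integrating it out
    merely adds weight to the Q-energy. This is why B and g must stay free in the induction.

    The slope [beta] may not depend on the fresh sample, otherwise [beta * c] would not be centred;
    hence [T] has to be a uniform bound over z. For the i.i.d. sum this would put the sup norm of
    eps in the leading term, where the trace of Sigma is wanted. That sum therefore gets a
    second-order expansion in which the square norm of eps is itself averaged.

    The size of [K] matters twice. The step-size condition gives
    [8 * kappa * CA ^+ 2 * p * alpha <= a], so [K <= 4 / 3 * p] lets the multiplicative noise
    consume at most a third of the drift [alpha * a]; and [2 * K <= p ^+ 2] yields the power 3/2 of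
    p in the martingale term.

    No conditional expectation is formed: the past is the sample space with a smaller sigma-algebra,
    and one-step bounds are integrated over a product space. *)

Lemma sinh_le_xcosh x : 0 <= x ->
  expR x - expR (- x) <= x * (expR x + expR (- x)).
Proof.
move=> x0.
pose f (y : R) := y * (expR y + expR (- y)) - (expR y - expR (- y)).
have fE (y : R) : is_derive y 1 f (y * (expR y - expR (- y))).
  rewrite /f; apply: is_derive_eq; rewrite /GRing.scale /=; ring.
suff : f 0 <= f x by rewrite /f mul0r oppr0 subrr subr0 subr_ge0.
apply: (@ger0_derive1_ndecry _ f 0) => // [y|].
- rewrite in_itv/= andbT => y0; rewrite derive1E derive_val.
  by rewrite mulr_ge0 ?(ltW y0)// subr_ge0 ler_expR; lra.
- by apply: derivable_within_continuous => y _; have [] := fE y.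
Qed.

Lemma cosh_le_gauss x : 0 <= x ->
  expR x + expR (- x) <= 2 * expR (x ^+ 2 / 2).
Proof.
move=> x0.
pose f (y : R) := (expR y + expR (- y)) * expR (- (y ^+ 2 / 2)).
have fE (y : R) : is_derive y 1 f
    ((expR y - expR (- y) - y * (expR y + expR (- y))) * expR (- (y ^+ 2 / 2))).
  by rewrite /f; apply: is_derive_eq; rewrite /GRing.scale /=; field.
suff : f x <= f 0.
  rewrite /f expr0n/= mul0r oppr0 expR0 mulr1 (expRN (_ / _)).
  by rewrite ler_pdivrMr ?expR_gt0 // -[1 + 1]/(2%:R).
apply: (@ler0_derive1_nincry _ f 0) => // [y|].
- rewrite in_itv/= andbT => y0; rewrite derive1E derive_val.
  by rewrite mulr_le0_ge0 ?expR_ge0// subr_le0 sinh_le_xcosh// ltW.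
- by apply: derivable_within_continuous => y _; have [] := fE y.
Qed.

Lemma expR_convex t x y : 0 <= t <= 1 ->
  expR (t * x + (1 - t) * y) <= t * expR x + (1 - t) * expR y.
Proof.
move=> /andP[t0 t1].
set m := t * x + _; set e := expR m.
have tangent z : e * (1 + (z - m)) <= expR z.
  rewrite -{2}(subrK m z) expRD mulrC ler_wpM2r ?expR_ge0//.
  by rewrite expR_ge1Dx.
have -> : e = t * (e * (1 + (x - m))) + (1 - t) * (e * (1 + (y - m))).
  rewrite /m; ring.
by rewrite lerD// ler_wpM2l// subr_ge0.
Qed.

(** Convexity of the exponential between [ln x] and 0, with weight s. *)
Lemma powR_le_tangent x s : 0 <= x -> 0 <= s <= 1 -> x `^ s <= 1 + s * (x - 1).
Proof.
move=> x0 /andP[s0 s1]; have [->|x_neq0] := eqVneq x 0.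
  have [->|sn0] := eqVneq s 0; first by rewrite powRr0; lra.
  by rewrite powR0//; lra.
have xgt0 : 0 < x by rewrite lt_def x_neq0.
rewrite /powR (negbTE x_neq0).
have := @expR_convex s (ln x) 0; rewrite s0 s1 => /(_ isT).
by rewrite mulr0 addr0 expR0 lnK ?posrE//; lra.
Qed.

(** The tangent bound for the concave exponent [r^-1] at the point [1 + r * x], raised to the power
    r. *)
Lemma bernoulli x r : 0 <= x -> 1 <= r -> 1 + r * x <= (1 + x) `^ r.
Proof.
move=> x0 r1; have r0 : 0 < r by lra.
have rx0 : 0 <= r * x by rewrite mulr_ge0// ltW.
have := @powR_le_tangent (1 + r * x) r^-1.
rewrite invr_ge0 (ltW r0) invf_le1// r1 => /(_ _ isT).
have -> : 1 + r^-1 * (1 + r * x - 1) = 1 + x by field; lra.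
move=> H; have {}H := H ltac:(lra).
have {1}-> : 1 + r * x = ((1 + r * x) `^ r^-1) `^ r.
  by rewrite -powRrM mulVf ?gt_eqF// powRr1//; lra.
by rewrite ge0_ler_powR ?nnegrE ?powR_ge0//; lra.
Qed.

(** Folds a first-order correction back into the base of the power; this is what lets the i.i.d.
    induction absorb a variance into B. *)
Lemma bernoulli_homogeneous x y r : 0 <= x -> 0 <= y -> 1 <= r ->
  x `^ r + r * y * x `^ (r - 1) <= (x + y) `^ r.
Proof.
move=> x0 y0 r1; have [->|xn0] := eqVneq x 0.
  have [->|rn1] := eqVneq r 1.
    by rewrite subrr powRr0 !powRr1 ?add0r//; lra.
  have r1' : r - 1 != 0 by rewrite subr_eq0.
  by rewrite !powR0 ?mulr0 ?addr0 ?powR_ge0//; lra.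
have xgt0 : 0 < x by rewrite lt_def xn0.
have -> : x + y = x * (1 + y / x) by field; lra.
have yx : 0 <= y / x by rewrite divr_ge0.
rewrite powRM//; last lra.
apply: (@le_trans _ _ (x `^ r * (1 + r * (y / x)))); last first.
  by rewrite ler_wpM2l ?powR_ge0// bernoulli.
rewrite -(@mulr_powRB1 _ x r)//; last lra.
by rewrite le_eqVlt; apply/orP; left; apply/eqP; field; lra.
Qed.

Lemma powR_square x r : 0 <= x -> (x ^+ 2) `^ (r / 2) = x `^ r.
Proof.
by move=> x0; rewrite -powR_mulrn// -powRrM; congr (_ `^ _); field.
Qed.

Lemma ler_powRl x y r : 0 <= r -> 0 <= x -> x <= y -> x `^ r <= y `^ r.
Proof. by move=> r0 x0 xy; rewrite ge0_ler_powR ?nnegrE// (le_trans x0). Qed.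

(** The chord of the exponential over [[- Y, Y]]. Being affine in y, it leaves only its constant
    cosh Y once a centred y is integrated. *)
Lemma expR_le_cosh_sinh (y Y : R) : `|y| <= Y -> 0 < Y ->
  expR y <= (expR Y + expR (- Y)) / 2 + y / Y * ((expR Y - expR (- Y)) / 2).
Proof.
move=> /ler_normlP[y1 y2] Y0.
have := @expR_convex ((1 + y / Y) / 2) Y (- Y).
have h1 : - 1 <= y / Y by rewrite ler_pdivlMr//; lra.
have h2 : y / Y <= 1 by rewrite ler_pdivrMr//; lra.
have -> : (1 + y / Y) / 2 * Y + (1 - (1 + y / Y) / 2) * - Y = y by field; lra.
by move=> /(_ ltac:(lra)); lra.
Qed.


(* Large p: after normalising by [S + K T], the gain [exp (- 2 r^2 T / (S + K T))]
   exactly compensates the sub-Gaussian factor coming from cosh. *)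
Lemma two_point_large S T r : 0 <= S -> 0 <= T -> 1 <= r ->
  exists beta, forall c v, c ^+ 2 <= S * T -> 0 <= v -> v <= S + 2 * c + T ->
    v `^ r <= (S + (2 * r + 1) * T) `^ r + beta * c.
Proof.
move=> S0 T0 r1; have r0 : 0 < r by lra.
(* The slope chosen below divides by [Y], which vanishes with [S * T]; in that case c = 0 and slope
   0 suffices. *)
have [ST0|STn0] := eqVneq (S * T) 0.
  exists 0 => c v; rewrite ST0 mul0r addr0 => c2 v0 vle.
  have c0 : c = 0 by apply/eqP; rewrite -sqrf_eq0 eq_le c2 sqr_ge0.
  apply: ler_powRl => //; first lra.
  by apply: (le_trans vle); rewrite c0 mulr0 addr0 lerD2l ler_peMl//; lra.
have STgt0 : 0 < S * T by rewrite lt_def STn0 mulr_ge0.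
have Sgt0 : 0 < S by rewrite lt_def S0 andbT; apply: contraNneq STn0 => ->; rewrite mul0r.
have Tgt0 : 0 < T by rewrite lt_def T0 andbT; apply: contraNneq STn0 => ->; rewrite mulr0.
set W := S + (2 * r + 1) * T.
have W0 : 0 < W by rewrite /W addr_gt0// mulr_gt0//; lra.
pose Y := 2 * r * Num.sqrt (S * T) / W.
have Y0 : 0 < Y by rewrite /Y divr_gt0// mulr_gt0 ?sqrtr_gt0//; lra.
pose G := expR (- (2 * r ^+ 2 * T / W)).
have G0 : 0 <= G := expR_ge0 _.
exists (W `^ r * (G * (2 * r / W / Y * ((expR Y - expR (- Y)) / 2)))) => c v c2 v0 vle.
pose y := 2 * r * c / W.
have ylt : `|y| <= Y.
  rewrite /y /Y normrM normrM (ger0_norm (x := 2 * r)); last lra.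
  rewrite (gtr0_norm (x := W^-1)) ?invr_gt0// ler_wpM2r ?invr_ge0 ?(ltW W0)//.
  by rewrite ler_wpM2l ?mulr_ge0 ?(ltW r0)// -sqrtr_sqr ler_wsqrtr.
have vW : v / W <= expR ((2 * c - 2 * r * T) / W).
  apply: le_trans (expR_ge1Dx _).
  rewrite ler_pdivrMr// mulrDl mul1r divfK ?gt_eqF// /W; lra.
have step1 : v `^ r <= W `^ r * (expR y * G).
  rewrite -[v in leLHS](divfK (negbT (gt_eqF W0))) mulrC powRM ?divr_ge0 ?(ltW W0)//.
  rewrite ler_wpM2l ?powR_ge0//.
  apply: (le_trans (ler_powRl (ltW r0) _ vW)); first by rewrite divr_ge0// ltW.
  rewrite /powR gt_eqF ?expR_gt0// expRK /G /y -expRD ler_expR.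
  by rewrite le_eqVlt; apply/orP; left; apply/eqP; field; lra.
apply: (le_trans step1); rewrite -mulrA -{2}[W `^ r]mulr1 -mulrDr.
rewrite ler_wpM2l ?powR_ge0//.
have := ler_wpM2r G0 (expR_le_cosh_sinh ylt Y0).
rewrite mulrDl => /le_trans; apply.
have coshG : (expR Y + expR (- Y)) / 2 * G <= 1.
  rewrite /G (expRN (2 * r ^+ 2 * T / W)) ler_pdivrMr ?expR_gt0// mul1r ler_pdivrMr//.
  apply: (le_trans (cosh_le_gauss (ltW Y0))); rewrite mulrC ler_wpM2r//.
  rewrite ler_expR ler_pdivrMr// /Y expr_div_n exprMn sqr_sqrtr ?(ltW STgt0)//.
  rewrite ler_pdivrMr ?exprn_gt0//.
  have -> : 2 * r ^+ 2 * T / W * 2 * W ^+ 2 = (2 * r) ^+ 2 * (T * W) by field; lra.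
  rewrite ler_wpM2l ?exprn_ge0 ?mulr_ge0 ?(ltW r0)// mulrC ler_wpM2l// /W lerDl.
  by rewrite mulr_ge0//; lra.
apply: (lerD coshG).
rewrite le_eqVlt; apply/orP; left; apply/eqP; rewrite /y; field; lra.
Qed.

(** For exponents up to 2, the factor of exponent [r - 1] lies below its tangent, so the left side
    is at most a quadratic in c whose square term is controlled by [c ^+ 2 <= S * T]; Bernoulli
    bounds the right side from below. This works when T is small relative to S. *)
Lemma two_point_small S T r : 0 <= S -> 0 <= T -> 1 <= r <= 2 ->
  exists beta, forall c v, c ^+ 2 <= S * T -> 0 <= v -> v <= S + 2 * c + T ->
    v `^ r <= (S + 2 * r * T) `^ r + beta * c.
Proof.
move=> S0 T0 /andP[r1 r2].
have [S00|Sn0] := eqVneq S 0.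
  exists 0 => c v; rewrite S00 !mul0r addr0 !add0r => c2 v0 vle.
  have c0 : c = 0 by apply/eqP; rewrite -sqrf_eq0 eq_le c2 sqr_ge0.
  apply: ler_powRl => //; first lra.
  by apply: (le_trans vle); rewrite c0 mulr0 add0r ler_peMl//; lra.
have Sgt0 : 0 < S by rewrite lt_def Sn0.
pose t := T / S; have t0 : 0 <= t by rewrite divr_ge0.
have TE : T = t * S by rewrite /t divfK.
have WE : S + 2 * r * T = S * (1 + 2 * r * t) by rewrite TE; ring.
(* At this threshold [c ^+ 2 <= S * T] already forces [2 * c <= (2 * r - 1) * T], so the bases
   compare pointwise and slope 0 works. *)
have [tbig|tsmall] := leP 4 ((2 * r - 1) ^+ 2 * t).
  exists 0 => c v c2 v0 vle; rewrite mul0r addr0; apply: ler_powRl => //; first lra.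
  apply: (le_trans vle); rewrite -addrA lerD2l.
  suff : 2 * c <= (2 * r - 1) * T by lra.
  have [cneg|cpos] := leP c 0.
    have : 0 <= (2 * r - 1) * T by rewrite mulr_ge0//; lra.
    by lra.
  rewrite -(@ler_pXn2r _ 2) ?nnegrE ?mulr_ge0//; try lra.
  rewrite exprMn [leRHS]exprMn (le_trans (ler_wpM2l _ c2))//.
  rewrite TE; have : 4 * (t * S ^+ 2) <= (2 * r - 1) ^+ 2 * t * (t * S ^+ 2).
    by rewrite ler_wpM2r// mulr_ge0// exprn_ge0.
  by lra.
(* The slope is the coefficient of c in [(1 + z) * (1 + (r - 1) * z)] for [z = (2 * c + T) / S],
   rescaled by the power of S. *)
exists (S `^ r * (2 * r / S + 4 * (r - 1) * t / S)) => c v c2 v0 vle.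
pose z := (2 * c + T) / S.
have vS : v <= S * (1 + z) by rewrite /z mulrDr mulr1 [S * (_ / _)]mulrC divfK//; lra.
have z0 : 0 <= 1 + z by rewrite -(pmulr_rge0 _ Sgt0); lra.
have zpow : (1 + z) `^ r <= (1 + z) * (1 + (r - 1) * z).
  rewrite -(mulr_powRB1 z0); last lra.
  rewrite ler_wpM2l//; have := @powR_le_tangent (1 + z) (r - 1) z0.
  by move=> /(_ ltac:(lra)); lra.
apply: (@le_trans _ _ (S `^ r * (1 + z) `^ r)).
  by rewrite -powRM//; apply: ler_powRl => //; lra.
have rt0 : 0 <= 2 * r * t by rewrite mulr_ge0//; lra.
rewrite WE (powRM _ S0); last lra.
rewrite -[_ * _ * c]mulrA -mulrDr ler_wpM2l ?powR_ge0// (le_trans zpow)//.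
have B : 1 + r * (2 * r * t) <= (1 + 2 * r * t) `^ r.
  exact: bernoulli.
suff : (1 + z) * (1 + (r - 1) * z) <=
   1 + r * (2 * r * t) + (2 * r / S + 4 * (r - 1) * t / S) * c by lra.
have zE : z = 2 * (c / S) + t by rewrite /z /t; field.
have cS : (c / S) ^+ 2 <= t.
  rewrite expr_div_n ler_pdivrMr ?exprn_gt0// (le_trans c2)// TE.
  by rewrite le_eqVlt; apply/orP; left; apply/eqP; ring.
have -> : (2 * r / S + 4 * (r - 1) * t / S) * c = (2 * r + 4 * (r - 1) * t) * (c / S) by field.
rewrite zE; set e := c / S in cS *.
have h1 : (r - 1) * (4 * e ^+ 2) <= (r - 1) * (4 * t) by rewrite ler_wpM2l//; lra.
suff : (r + 4 * (r - 1)) * t + (r - 1) * t ^+ 2 <= 2 * r ^+ 2 * t by lra.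
suff : 0 <= t * (2 * r ^+ 2 - 5 * r + 4 - (r - 1) * t) by lra.
rewrite mulr_ge0//.
have k0 : 0 < (2 * r - 1) ^+ 2 by rewrite exprn_gt0//; lra.
rewrite -(pmulr_rge0 _ k0).
have h2 : (r - 1) * ((2 * r - 1) ^+ 2 * t) <= (r - 1) * 4 by rewrite ler_wpM2l//; lra.
suff : 4 * (r - 1) <= (2 * r - 1) ^+ 2 * (2 * r ^+ 2 - 5 * r + 4) by lra.
have -> : r = 1 + (r - 1) by ring.
have : 0 <= r - 1 by lra.
move: (r - 1) => q q0; nra.
Qed.

(** The large-exponent constant [p + 1] violates both upper bounds on K at p = 2, whereas the
    small-exponent constant [p] meets them; beyond p = 4 the value [p + 1] meets them too. *)
Lemma two_point (p : R) : 2 <= p -> exists K : R,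
  [/\ 0 <= K, K <= 4 / 3 * p, 2 * K <= p ^+ 2 &
   forall S T, 0 <= S -> 0 <= T -> exists beta, forall c v,
     c ^+ 2 <= S * T -> 0 <= v -> v <= S + 2 * c + T ->
     v `^ (p / 2) <= (S + K * T) `^ (p / 2) + beta * c].
Proof.
move=> p2; have [p4|p4] := leP p 4.
  exists p; split; try nra; move=> S T S0 T0.
  have := @two_point_small S T (p / 2) S0 T0 ltac:(lra).
  by have -> : 2 * (p / 2) = p by field.
exists (p + 1); split; try nra; move=> S T S0 T0.
have := @two_point_large S T (p / 2) S0 T0 ltac:(lra).
by have -> : 2 * (p / 2) = p by field.
Qed.

(** Stated for a homogeneous quadratic in two scalars so that Cauchy-Schwarz for any semidefinite
    form, including the joint energy, is an instance. *)
Lemma discriminant_le0 (a b c : R) :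
  (forall s t, 0 <= s ^+ 2 * a + 2 * (s * t * b) + t ^+ 2 * c) -> b ^+ 2 <= a * c.
Proof.
move=> H.
have c0 : 0 <= c by have := H 0 1; lra.
have [cz|cn] := eqVneq c 0.
  have [->|bn] := eqVneq b 0; first by rewrite cz mulr0 expr0n.
  (* When c = 0 the quadratic is affine in t; this t gives it the value -1. *)
  have := H 1 (- (a + 1) / (2 * b)).
  have -> : 1 ^+ 2 * a + 2 * (1 * (- (a + 1) / (2 * b)) * b) +
      (- (a + 1) / (2 * b)) ^+ 2 * c = - 1 by rewrite cz; field.
  by lra.
have cgt0 : 0 < c by rewrite lt_def cn.
rewrite -(ler_pM2l cgt0).
by have := H c (- b); lra.
Qed.

End ScalarInequalities.

(** * Bilinear forms, Euclidean norm and operator norm *)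

Section LinearAlgebra.
Context {R : realType}.

(** [vnorm] and [Qnorm] are square roots of its diagonal at [1%:M] and at [Q]; computing with the
    form keeps everything polynomial. *)
Definition form d (Q : 'M[R]_d) (u v : 'cV[R]_d) : R := (u^T *m Q *m v) 0 0.

Section Form.
Context {d : nat}.
Implicit Types (Q B : 'M[R]_d) (u v w x y : 'cV[R]_d).

Lemma formDl Q u v w : form Q (u + v) w = form Q u w + form Q v w.
Proof. by rewrite /form linearD /= !mulmxDl mxE. Qed.

Lemma formDr Q u v w : form Q w (u + v) = form Q w u + form Q w v.
Proof. by rewrite /form mulmxDr mxE. Qed.

Lemma formZl Q a u v : form Q (a *: u) v = a * form Q u v.
Proof. by rewrite /form linearZ /= -!scalemxAl mxE. Qed.

Lemma formZr Q a u v : form Q u (a *: v) = a * form Q u v.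
Proof. by rewrite /form -scalemxAr mxE. Qed.

Lemma formNl Q u v : form Q (- u) v = - form Q u v.
Proof. by rewrite -scaleN1r formZl mulN1r. Qed.

Lemma formNr Q u v : form Q u (- v) = - form Q u v.
Proof. by rewrite -scaleN1r formZr mulN1r. Qed.

Lemma form_tr Q u v : form Q u v = form Q^T v u.
Proof.
rewrite /form -[in LHS](trmxK (u^T *m Q *m v)) [LHS]mxE.
by rewrite !trmx_mul trmxK mulmxA.
Qed.

Lemma form_sym Q u v : symmetric_mx Q -> form Q u v = form Q v u.
Proof. by move=> QT; rewrite form_tr QT. Qed.

Lemma form_shift Q a u v : form (Q - a%:M) u v = form Q u v - a * form 1%:M u v.
Proof. by rewrite /form mulmxBr mulmxBl mul_mx_scalar -scalemxAl mulmx1 !mxE. Qed.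

Lemma form_sum Q u v : form Q u v = \sum_j \sum_i u i 0 * Q i j * v j 0.
Proof.
rewrite /form mxE; apply: eq_bigr => j _; rewrite mxE mulr_suml.
by apply: eq_bigr => i _; rewrite mxE.
Qed.

Lemma dot_sum u v : form 1%:M u v = \sum_i u i 0 * v i 0.
Proof. by rewrite /form mulmx1 mxE; apply: eq_bigr => i _; rewrite mxE. Qed.

Lemma dot_self_ge0 u : 0 <= form 1%:M u u.
Proof. by rewrite dot_sum sumr_ge0// => i _; rewrite -expr2 sqr_ge0. Qed.

Lemma sqr_vnorm u : vnorm u ^+ 2 = form 1%:M u u.
Proof.
by rewrite /vnorm sqr_sqrtr ?sumr_ge0// => [|i _]; rewrite ?sqr_ge0// dot_sum.
Qed.

Lemma vnorm_ge0 u : 0 <= vnorm u. Proof. exact: sqrtr_ge0. Qed.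

Lemma sqr_Qnorm Q u : 0 <= form Q u u -> Qnorm Q u ^+ 2 = form Q u u.
Proof. by move=> h; rewrite /Qnorm sqr_sqrtr. Qed.

Lemma vnormE u : vnorm u = Num.sqrt (form 1%:M u u).
Proof. by rewrite -sqr_vnorm sqrtr_sqr ger0_norm// vnorm_ge0. Qed.

Lemma form_cauchy_schwarz Q u v : symmetric_mx Q -> (forall x, 0 <= form Q x x) ->
  form Q u v ^+ 2 <= form Q u u * form Q v v.
Proof.
move=> QT Q0; apply: discriminant_le0 => s t.
have := Q0 (s *: u + t *: v).
rewrite formDl !formDr !formZl !formZr (form_sym v u QT); lra.
Qed.

Lemma symmetric_mx1 : symmetric_mx (1%:M : 'M[R]_d).
Proof. by rewrite /symmetric_mx trmx1. Qed.

Lemma dot_cauchy_schwarz u v : form 1%:M u v ^+ 2 <= vnorm u ^+ 2 * vnorm v ^+ 2.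
Proof.
rewrite !sqr_vnorm; apply: form_cauchy_schwarz; first exact: symmetric_mx1.
exact: dot_self_ge0.
Qed.

Lemma dot_le_vnorm u v : `|form 1%:M u v| <= vnorm u * vnorm v.
Proof.
rewrite -(@ler_pXn2r _ 2) ?nnegrE ?mulr_ge0 ?vnorm_ge0//.
by rewrite exprMn real_normK ?num_real// dot_cauchy_schwarz.
Qed.

Lemma vnorm_eq0 u : vnorm u = 0 -> u = 0.
Proof.
move=> u0; have : vnorm u ^+ 2 == 0 by rewrite u0 expr0n.
rewrite sqr_vnorm dot_sum psumr_eq0 => [/allP h|i _]; last by rewrite -expr2 sqr_ge0.
apply/colP => i; rewrite mxE.
by have := h i; rewrite mem_index_enum mulf_eq0 orbb => /(_ isT)/eqP.
Qed.

Lemma vnorm0 : vnorm (0 : 'cV[R]_d) = 0.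
Proof. by rewrite /vnorm big1 ?sqrtr0// => i _; rewrite mxE expr0n. Qed.

Lemma vnorm_gt0 u : u != 0 -> 0 < vnorm u.
Proof.
by move=> un0; rewrite lt_def vnorm_ge0 andbT; apply: contraNneq un0 => /vnorm_eq0 ->.
Qed.

Lemma vnormZ a u : vnorm (a *: u) = `|a| * vnorm u.
Proof.
rewrite !vnormE formZl formZr mulrA -expr2 sqrtrM ?sqr_ge0//.
by rewrite sqrtr_sqr.
Qed.

Lemma vnormN u : vnorm (- u) = vnorm u.
Proof. by rewrite -scaleN1r vnormZ normrN1 mul1r. Qed.

Lemma vnormD u v : vnorm (u + v) <= vnorm u + vnorm v.
Proof.
rewrite -(@ler_pXn2r _ 2) ?nnegrE ?addr_ge0 ?vnorm_ge0//.
rewrite sqrrD !sqr_vnorm formDl !formDr (form_sym v u symmetric_mx1).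
by have := ler_normlW (dot_le_vnorm u v); lra.
Qed.

Lemma vnorm_sum (I : Type) (s : seq I) (F : I -> 'cV[R]_d) :
  vnorm (\sum_(i <- s) F i) <= \sum_(i <- s) vnorm (F i).
Proof.
elim: s => [|i s IH]; first by rewrite !big_nil vnorm0.
by rewrite !big_cons (le_trans (vnormD _ _))// lerD2l.
Qed.

Lemma normr_coord_le u i : `|u i 0| <= vnorm u.
Proof.
rewrite -(@ler_pXn2r _ 2) ?nnegrE ?vnorm_ge0//.
rewrite real_normK ?num_real// sqr_vnorm dot_sum (bigD1 i)//= -expr2 lerDl.
by apply: sumr_ge0 => j _; rewrite -expr2 sqr_ge0.
Qed.

Lemma form_bounded Q : exists2 C, 0 <= C & forall u v, `|form Q u v| <= C * (vnorm u * vnorm v).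
Proof.
exists (\sum_j \sum_i `|Q i j|) => [|u v].
  by apply: sumr_ge0 => j _; apply: sumr_ge0.
rewrite form_sum mulr_suml (le_trans (ler_norm_sum _ _ _))// ler_sum// => j _.
rewrite mulr_suml (le_trans (ler_norm_sum _ _ _))// ler_sum// => i _.
rewrite !normrM -mulrA mulrCA ler_wpM2l// ler_pM//; exact: normr_coord_le.
Qed.

Lemma sqr_vnorm_mulmx B u : vnorm (B *m u) ^+ 2 = form (B^T *m B) u u.
Proof. by rewrite sqr_vnorm /form mulmx1 trmx_mul !mulmxA. Qed.

Lemma mulmx_bounded B : exists2 C, 0 <= C & forall u, vnorm (B *m u) <= C * vnorm u.
Proof.
have [C C0 HC] := form_bounded (B^T *m B).
exists (Num.sqrt C) => [|u]; first exact: sqrtr_ge0.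
rewrite -(@ler_pXn2r _ 2) ?nnegrE ?mulr_ge0 ?vnorm_ge0 ?sqrtr_ge0//.
rewrite exprMn (sqr_sqrtr C0) sqr_vnorm_mulmx expr2.
exact: le_trans (ler_norm _) (HC _ _).
Qed.

(** Since [opnorm] is a real supremum, its set must first be shown bounded, which [mulmx_bounded]
    provides; rescaling u to the unit sphere does the rest. *)
Lemma vnorm_mulmx_le B u : vnorm (B *m u) <= opnorm B * vnorm u.
Proof.
have [->|un0] := eqVneq u 0; first by rewrite mulmx0 vnorm0 mulr0.
have u0 := vnorm_gt0 un0.
have [C C0 HC] := mulmx_bounded B.
rewrite -ler_pdivrMr// mulrC -[(vnorm u)^-1]ger0_norm ?invr_ge0 ?(ltW u0)//.
rewrite -vnormZ scalemxAr; apply: ub_le_sup.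
  by exists C => _ [x /= x1 <-]; rewrite (le_trans (HC x))// x1 mulr1.
exists ((vnorm u)^-1 *: u) => //=.
by rewrite vnormZ ger0_norm ?invr_ge0 ?(ltW u0)// mulVf// gt_eqF.
Qed.

Lemma form_ge0_posdef Q : posdef_mx Q -> forall u, 0 <= form Q u u.
Proof.
move=> Q0 u; have [->|un0] := eqVneq u 0; last exact: ltW (Q0 _ un0).
by rewrite /form mulmx0 mxE.
Qed.

Lemma Qnorm_ge0 Q u : 0 <= Qnorm Q u. Proof. exact: sqrtr_ge0. Qed.

Lemma QnormZ Q a u : Qnorm Q (a *: u) = `|a| * Qnorm Q u.
Proof.
rewrite /Qnorm -/(form Q _ _) -/(form Q u u) formZl formZr mulrA -expr2 sqrtrM ?sqr_ge0//.
by rewrite sqrtr_sqr.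
Qed.

End Form.

(** * Extreme eigenvalues of symmetric matrices *)

Section Spectrum.
Context {d : nat}.
Implicit Types (Q B : 'M[R]_d) (u v w x y : 'cV[R]_d).
Hypothesis d_gt0 : (0 < d)%N.

Lemma unit_vector : exists u : 'cV[R]_d, vnorm u = 1.
Proof.
pose u : 'cV[R]_d := const_mx 1.
have un0 : u != 0.
  apply/eqP => /colP/(_ (Ordinal d_gt0)); rewrite !mxE => /eqP.
  by rewrite oner_eq0.
exists ((vnorm u)^-1 *: u).
by rewrite vnormZ ger0_norm ?invr_ge0 ?vnorm_ge0// mulVf// gt_eqF// vnorm_gt0.
Qed.

Lemma opnorm_ge0 B : 0 <= opnorm B.
Proof.
have [u u1] := unit_vector; have := vnorm_mulmx_le B u.
by rewrite u1 mulr1; apply: le_trans; exact: vnorm_ge0.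
Qed.

(* An invertible positive semidefinite form is bounded below, by Cauchy-Schwarz
   applied to [x] and [N^-1 x]. *)
Lemma psd_unit_bounded_below N : symmetric_mx N -> (forall u, 0 <= form N u u) ->
  N \in unitmx -> exists2 C, 0 < C & forall u, vnorm u ^+ 2 <= C * form N u u.
Proof.
move=> NT N0 Nu; have [C C0 HC] := form_bounded (invmx N).
exists (C + 1) => [|u]; first lra.
pose y := invmx N *m u.
have NyE : N *m y = u by rewrite /y mulKVmx.
have e1 : form N u y = vnorm u ^+ 2.
  by rewrite sqr_vnorm /form mulmx1 -mulmxA NyE.
have e2 : form N y y = form (invmx N) u u.
  have -> : form N y y = form 1%:M y u by rewrite /form mulmx1 -mulmxA NyE.
  by rewrite (form_sym _ _ symmetric_mx1) /form mulmx1 mulmxA.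
have := form_cauchy_schwarz u y NT N0; rewrite e1 e2 => h.
have h2 := le_trans (ler_norm _) (HC u u).
have [->|un0] := eqVneq u 0; first by rewrite vnorm0 expr0n /= /form mulmx0 mxE mulr0.
have u0 : 0 < vnorm u ^+ 2 by rewrite exprn_gt0// vnorm_gt0.
rewrite -(ler_pM2r u0) -expr2 (le_trans h)// mulrAC mulrC ler_wpM2r//.
by rewrite (le_trans h2)// -expr2 ler_wpM2r ?sqr_ge0//; lra.
Qed.

(** A proof without compactness: let [mu] be the infimum of the form on the unit sphere. If mu were
    not an eigenvalue, [Q - mu%:M] would be semidefinite and invertible, hence bounded below by some
    [D^-1 > 0] on the sphere, and the infimum would exceed itself. *)
Lemma rayleigh_min_eigenvalue Q : symmetric_mx Q ->
  exists2 mu, eigenvalue Q mu & forall u, mu * vnorm u ^+ 2 <= form Q u u.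
Proof.
move=> QT.
pose E := [set form Q u u | u in [set u : 'cV[R]_d | vnorm u = 1]].
have [C C0 HC] := form_bounded Q.
have [e e1] := unit_vector.
have Elb : lbound E (- C).
  move=> _ [u /= u1 <-]; have := HC u u.
  by rewrite u1 !mulr1 => /ler_normlP[]; lra.
have Einf : has_inf E by split; [exists (form Q e e); exists e|exists (- C)].
pose mu := inf E.
have muP u : mu * vnorm u ^+ 2 <= form Q u u.
  have [->|un0] := eqVneq u 0; first by rewrite vnorm0 expr0n /= /form mulmx0 mxE mulr0.
  have u0 := vnorm_gt0 un0.
  rewrite -ler_pdivlMr ?exprn_gt0//.
  have -> : form Q u u / vnorm u ^+ 2 = form Q ((vnorm u)^-1 *: u) ((vnorm u)^-1 *: u).
    by rewrite formZl formZr; field; rewrite gt_eqF.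
  apply: ge_inf; first by exists (- C).
  exists ((vnorm u)^-1 *: u) => //=.
  by rewrite vnormZ ger0_norm ?invr_ge0 ?(ltW u0)// mulVf// gt_eqF.
exists mu => //; apply: contraT => muN.
pose N := Q - mu%:M.
have NT : symmetric_mx N by rewrite /symmetric_mx /N linearB /= QT tr_scalar_mx.
have N0 u : 0 <= form N u u by rewrite form_shift -sqr_vnorm subr_ge0.
have Nu : N \in unitmx.
  rewrite -row_free_unit -kermx_eq0; apply/negPn/negP => h; apply: (negP muN); exact: h.
have [D D0 HD] := psd_unit_bounded_below NT N0 Nu.
have : mu + D^-1 <= mu.
  apply: lb_le_inf; first by case: Einf.
  move=> _ [u /= u1 <-]; have := HD u; rewrite form_shift -sqr_vnorm u1 expr1n mulr1.
  by rewrite mulrC -ler_pdivrMr// div1r; lra.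
by have := invr_gt0 D; rewrite D0 => ?; lra.
Qed.

Lemma eigenvalueN Q a : eigenvalue (- Q) a = eigenvalue Q (- a).
Proof.
apply/eigenvalueP/eigenvalueP => -[v vQ vn0]; exists v => //.
  by rewrite -[Q]opprK mulmxN vQ scaleNr.
by rewrite mulmxN vQ scaleNr opprK.
Qed.

Lemma rayleigh_max_eigenvalue Q : symmetric_mx Q ->
  exists2 mu, eigenvalue Q mu & forall u, form Q u u <= mu * vnorm u ^+ 2.
Proof.
move=> QT; have NQT : symmetric_mx (- Q) by rewrite /symmetric_mx linearN /= QT.
have [mu mue muP] := rayleigh_min_eigenvalue NQT.
exists (- mu) => [|u]; first by rewrite -eigenvalueN.
by have := muP u; rewrite /form mulmxN mulNmx mxE; lra.
Qed.

Lemma eigenvalue_rayleigh Q a : symmetric_mx Q -> eigenvalue Q a ->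
  exists2 u, u != 0 & form Q u u = a * vnorm u ^+ 2.
Proof.
move=> QT /eigenvalueP[v vQ vn0]; exists v^T.
  by apply: contraNneq vn0 => h; rewrite -[v]trmxK h trmx0.
by rewrite sqr_vnorm /form trmxK vQ mulmx1 -scalemxAl mxE.
Qed.

Lemma lambda_min_eigenvalue Q : symmetric_mx Q -> eigenvalue Q (lambda_min Q) /\
  forall u, lambda_min Q * vnorm u ^+ 2 <= form Q u u.
Proof.
move=> QT; have [mu mue muP] := rayleigh_min_eigenvalue QT.
suff -> : lambda_min Q = mu by [].
have muL : lbound [set a | eigenvalue Q a] mu.
  move=> a /= /(eigenvalue_rayleigh QT)[u un0 uE].
  by have := muP u; rewrite uE ler_pM2r// exprn_gt0// vnorm_gt0.
apply/eqP; rewrite eq_le; apply/andP; split.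
  by apply: ge_inf => //; exists mu.
by apply: lb_le_inf => //; exists mu.
Qed.

Lemma lambda_max_eigenvalue Q : symmetric_mx Q -> eigenvalue Q (lambda_max Q) /\
  forall u, form Q u u <= lambda_max Q * vnorm u ^+ 2.
Proof.
move=> QT; have [mu mue muP] := rayleigh_max_eigenvalue QT.
suff -> : lambda_max Q = mu by [].
have muL : ubound [set a | eigenvalue Q a] mu.
  move=> a /= /(eigenvalue_rayleigh QT)[u un0 uE].
  by have := muP u; rewrite uE ler_pM2r// exprn_gt0// vnorm_gt0.
apply/eqP; rewrite eq_le; apply/andP; split.
  by apply: ge_sup => //; exists mu.
by apply: ub_le_sup => //; exists mu.
Qed.

Lemma lambda_min_gt0 Q : symmetric_mx Q -> posdef_mx Q -> 0 < lambda_min Q.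
Proof.
move=> QT Q0; have [/(eigenvalue_rayleigh QT)[u un0 uE] _] := lambda_min_eigenvalue QT.
have := Q0 u un0; rewrite -/(form Q u u) uE pmulr_lgt0// exprn_gt0// vnorm_gt0//.
Qed.

Lemma lambda_min_le_max Q : symmetric_mx Q -> lambda_min Q <= lambda_max Q.
Proof.
move=> QT; have [_ h1] := lambda_min_eigenvalue QT.
have [_ h2] := lambda_max_eigenvalue QT.
have [u u1] := unit_vector.
by have := le_trans (h1 u) (h2 u); rewrite u1 expr1n !mulr1.
Qed.

Lemma form_le_opnorm Q u : form Q u u <= opnorm Q * vnorm u ^+ 2.
Proof.
have -> : form Q u u = form 1%:M u (Q *m u) by rewrite /form mulmx1 mulmxA.
apply: (le_trans (ler_norm _)); apply: (le_trans (dot_le_vnorm _ _)).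
by rewrite expr2 mulrCA ler_wpM2l ?vnorm_ge0// vnorm_mulmx_le.
Qed.

Lemma Qnorm_mulmx_le Q B u : symmetric_mx Q -> posdef_mx Q ->
  Qnorm Q (B *m u) <= Qopnorm Q B * Qnorm Q u.
Proof.
move=> QT Q0.
have [->|un0] := eqVneq u 0.
  rewrite mulmx0; suff -> : Qnorm Q (0 : 'cV_d) = 0 by rewrite mulr0.
  by rewrite /Qnorm mulmx0 mxE sqrtr0.
have l0 := lambda_min_gt0 QT Q0.
have [_ lmin] := lambda_min_eigenvalue QT.
have [_ lmax] := lambda_max_eigenvalue QT.
have L0 : 0 < lambda_max Q := lt_le_trans l0 (lambda_min_le_max QT).
have u0 : 0 < Qnorm Q u by rewrite sqrtr_gt0 Q0.
have [C C0 HC] := mulmx_bounded B.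
rewrite -ler_pdivrMr// mulrC -[(Qnorm Q u)^-1]ger0_norm ?invr_ge0 ?(ltW u0)//.
rewrite -QnormZ scalemxAr; apply: ub_le_sup; last first.
  exists ((Qnorm Q u)^-1 *: u) => //=.
  by rewrite QnormZ ger0_norm ?invr_ge0 ?(ltW u0)// mulVf// gt_eqF.
(* An upper bound making the supremum meaningful: pass from the Q-norm to the Euclidean norm through
   [lambda_max], and back through [lambda_min]. *)
exists (Num.sqrt (lambda_max Q * C ^+ 2 / lambda_min Q)) => _ [x /= x1 <-].
apply: ler_wsqrtr; apply: (le_trans (lmax _)).
have x2 : form Q x x = 1.
  by rewrite -(sqr_Qnorm (form_ge0_posdef Q0 x)) x1 expr1n.
rewrite -mulrA ler_wpM2l ?(ltW L0)//.
have h : vnorm (B *m x) ^+ 2 <= C ^+ 2 * vnorm x ^+ 2.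
  by rewrite -exprMn ler_pXn2r ?nnegrE ?mulr_ge0 ?vnorm_ge0.
apply: (le_trans h); rewrite ler_wpM2l ?exprn_ge0//.
by rewrite -[leRHS]mul1r ler_pdivlMr// mulrC -x2.
Qed.

End Spectrum.
End LinearAlgebra.

(** * Independence of a fresh sample from the past *)

Section FreshSample.
Context {R : realType} {dZ dO : measure_display}.
Context {Zt : measurableType dZ} {Om : measurableType dO}.
Variables (pi : probability Zt R) (P : probability Om R) (Z : nat -> Om -> Zt).
Hypothesis iidZ : iid_seq pi P Z.

(** Rectangles in the first n samples: a pi-system on which independence is exactly the product
    formula of [iid_seq]. *)
Definition history (n : nat) : set (set Om) :=
  [set C | exists2 B : nat -> set Zt, (forall k, measurable (B k)) &
     C = \bigcap_(k in [set k | (0 < k <= n)%N]) (Z k @^-1` B k)].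

(** The sample space carrying the sigma-algebra of the first n samples. Adaptedness becomes ordinary
    measurability, and a past together with a new sample lives in a product space. *)
Definition past (n : nat) := g_sigma_algebraType (history n).

Lemma measurable_sample k : (0 < k)%N -> measurable_fun setT (Z k).
Proof. by case: iidZ => h _; exact: h. Qed.

Lemma history_measurable n : history n `<=` measurable.
Proof.
move=> _ [B mB ->]; apply: bigcap_measurableType => k /= /andP[k0 _].
by rewrite -[X in measurable X]setTI; exact: measurable_sample.
Qed.

Lemma past_measurable n (C : set Om) :
  measurable (C : set (past n)) -> measurable C.
Proof. exact: (smallest_sub (@sigma_algebra_measurable _ Om) (@history_measurable n)). Qed.

Lemma historyT n : history n setT.
Proof.
by exists (fun=> setT) => //; apply/seteqP; split.
Qed.

Lemma history_setI n : setI_closed (history n).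
Proof.
move=> _ _ [B mB ->] [B' mB' ->]; exists (fun k => B k `&` B' k).
  by move=> k; exact: measurableI.
apply/seteqP; split => [w [h1 h2] k kI|w h].
  by split; [exact: h1|exact: h2].
by split => k kI; have [] := h k kI.
Qed.

Lemma measurable_past_sample n k : (0 < k <= n)%N ->
  measurable_fun setT (Z k : past n -> Zt).
Proof.
move=> /andP[k0 kn] _ D mD; rewrite setTI.
apply: sub_sigma_algebra.
exists (fun j => if j == k then D else setT).
  by move=> j; case: ifP.
apply/seteqP; split => [w /= h j _|w /= /(_ k)/=].
  by case: eqP => [->|].
by rewrite eqxx; apply; lia.
Qed.

Lemma history_indep n C D : history n C -> measurable D ->
  P (C `&` Z n.+1 @^-1` D) = (P C * pi D)%E.
Proof.
move=> [B mB ->] mD; case: iidZ => mZ [lawZ indepZ].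
pose B' k := if k == n.+1 then D else B k.
have mB' k : measurable (B' k) by rewrite /B'; case: ifP.
have inI m k : (k \in iota 1 m) = (0 < k <= m)%N by rewrite mem_iota add1n ltnS.
have setI m : [set k | (0 < k <= m)%N] = [set k | k \in iota 1 m].
  by apply/seteqP; split => k /=; rewrite inI.
have -> : \bigcap_(k in [set k | (0 < k <= n)%N]) (Z k @^-1` B k) `&` Z n.+1 @^-1` D =
  \bigcap_(k in [set k | k \in iota 1 n.+1]) (Z k @^-1` B' k).
  rewrite -setI; apply/seteqP; split => [w [h1 h2] k kn|w h].
    rewrite /B' /preimage /=; case: eqP => [->//|kN].
    by apply: h1; move: kn => /=; lia.
  split => [k kn|].
    have := h k; rewrite /B' /preimage /=; move: kn => /=.
    by case: eqP => [|_] kn; [lia|apply; lia].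
  by have := h n.+1; rewrite /B' /preimage /= eqxx; apply; lia.
rewrite setI indepZ//; [|exact: iota_uniq|]; last first.
  by apply/allP => k; rewrite mem_iota => /andP[].
rewrite (indepZ (iota 1 n))//; [|exact: iota_uniq|]; last first.
  by apply/allP => k; rewrite mem_iota => /andP[].
rewrite -[n.+1]addn1 iotaD big_cat/= big_seq1 add1n lawZ// {2}/B' eqxx.
congr (_ * _)%E; apply: eq_big_seq => k; rewrite mem_iota /B'.
by case: eqP => // ->; lia.
Qed.

(** For fixed D, both sides are finite measures in C that agree on the generating pi-system, hence
    everywhere. *)
Lemma past_indep n (C : set (past n)) D : measurable C -> measurable D ->
  P (C `&` Z n.+1 @^-1` D) = (P C * pi D)%E.
Proof.
move=> mC mD.
have mZD : measurable (Z n.+1 @^-1` D).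
  by rewrite -[X in measurable X]setTI; exact: measurable_sample.
have piD : pi D \is a fin_num by exact: fin_num_measure.
have piD0 : 0 <= fine (pi D) by exact: fine_ge0.
pose m1 := mrestr P mZD.
pose m2 := mscale (NngNum piD0) P.
have : m1 C = m2 C.
  apply: (@g_sigma_algebra_measure_unique _ _ _ (history n) _ (fun=> setT)) => //.
  - exact: history_measurable.
  - by move=> _; exact: historyT.
  - by rewrite bigcup_const.
  - exact: history_setI.
  - move=> A hA; apply: (etrans (history_indep hA mD)).
    change ((P A * pi D)%E = ((fine (pi D))%:E * P A)%E).
    by rewrite fineK// muleC.
  - move=> _; change (P (setT `&` Z n.+1 @^-1` D) < +oo)%E; rewrite setTI.
    by apply: (le_lt_trans (probability_le1 P mZD)); rewrite ltry.
by rewrite /m1 /m2 /mrestr /mscale/= fineK// muleC.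
Qed.

Let id_past n : Om -> past n := id.

Lemma measurable_id_past n : measurable_fun setT (id_past n).
Proof. by move=> _ C mC; rewrite setTI; exact: (@past_measurable n C mC). Qed.

Lemma measurable_from_past d' (T : measurableType d') n (f : past n -> T) :
  measurable_fun setT f -> measurable_fun setT (f : Om -> T).
Proof.
by move=> mf; apply: (measurableT_comp mf); exact: measurable_id_past.
Qed.

Lemma past_widen d' (T : measurableType d') n m (f : Om -> T) : (n <= m)%N ->
  measurable_fun setT (f : past n -> T) -> measurable_fun setT (f : past m -> T).
Proof.
move=> nm mf _ D mD; have := mf measurableT D mD; rewrite !setTI.
apply: smallest_sub; first exact: smallest_sigma_algebra.
move=> _ [B mB ->]; apply: sub_sigma_algebra.
exists (fun k => if (k <= n)%N then B k else setT).
  by move=> k; case: ifP.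
apply/seteqP; split => w h k kI; rewrite /preimage /=; last first.
  have kn : (k <= n)%N by move: kI => /=; lia.
  by have := h k; rewrite /preimage /= kn; apply; move: kI => /=; lia.
by case: leqP => // kn; apply: h; move: kI => /=; lia.
Qed.

(* Tonelli for the joint law of the past and a fresh sample. *)
Lemma fresh_sample_le n (Psi : past n * Zt -> \bar R) (g : past n -> \bar R) :
  measurable_fun setT Psi -> (forall x, 0 <= Psi x)%E ->
  measurable_fun setT g -> (forall w, \int[pi]_z Psi (w, z) <= g w)%E ->
  (\int[P]_w Psi (w, Z n.+1 w) <= \int[P]_w g w)%E.
Proof.
move=> mPsi Psi0 mg le_g.
have mZ := measurable_sample (ltn0Sn n).
have g0 w : (0 <= g w)%E by apply: le_trans (le_g w); apply: integral_ge0.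
pose idm : {mfun Om >-> past n} :=
  HB.pack (id_past n) (isMeasurableFun.Build _ _ _ _ _ (@measurable_id_past n)).
pose joint : Om -> past n * Zt := fun w => (id_past n w, Z n.+1 w).
have mjoint : measurable_fun setT joint.
  by apply/measurable_fun_pairP; split; [exact: measurable_id_past|exact: mZ].
pose jointm : {mfun Om >-> (past n * Zt)%type} :=
  HB.pack joint (isMeasurableFun.Build _ _ _ _ _ mjoint).
pose P1 : probability (past n) R := distribution P idm.
pose P2 : probability (past n * Zt)%type R := distribution P jointm.
have P2E X : measurable X -> (P1 \x pi)%E X = P2 X.
  apply: product_measure_unique => C D mC mD.
  rewrite /P2 /P1 /distribution /pushforward /=.
  rewrite -(past_indep mC mD); congr (P _).
have -> : (\int[P]_w Psi (w, Z n.+1 w) = \int[P2]_x Psi x)%E.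
  by rewrite ge0_integral_distribution.
have -> : (\int[P2]_x Psi x = \int[P1 \x pi]_x Psi x)%E.
  by apply: eq_measure_integral => X mX _; exact/esym/P2E.
rewrite fubini_tonelli1//.
have -> : (\int[P]_w g w = \int[P1]_w g w)%E.
  by rewrite ge0_integral_distribution.
apply: ge0_le_integral => //.
- by move=> w _; apply: integral_ge0.
- exact: measurable_fun_fubini_tonelli_F.
- by move=> w _; exact: le_g.
Qed.

End FreshSample.

(** * Measurability of vector- and matrix-valued maps, by coordinates *)

Section MeasurableVectors.
Context {R : realType} {d : nat}.

Definition vmeasurable dT (T : measurableType dT) (f : T -> 'cV[R]_d) :=
  forall i, measurable_fun setT (fun t => f t i 0).

Definition mmeasurable dT (T : measurableType dT) (F : T -> 'M[R]_d) :=
  forall i j, measurable_fun setT (fun t => F t i j).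

Context {dT dT' : measure_display} {T : measurableType dT} {T' : measurableType dT'}.
Implicit Types (f g : T -> 'cV[R]_d) (F : T -> 'M[R]_d).

Lemma measurable_bigsum (I : Type) (s : seq I) (h : I -> T -> R) :
  (forall i, measurable_fun setT (h i)) ->
  measurable_fun setT (fun t => \sum_(i <- s) h i t).
Proof.
move=> mh; elim: s => [|i s IH].
  by under eq_fun do rewrite big_nil; exact: measurable_cst.
apply: (eq_measurable_fun (fun t => h i t + \sum_(i <- s) h i t)).
  by move=> t _; rewrite big_cons.
exact: measurable_funD.
Qed.

Lemma vmeasurable_cst v : vmeasurable (fun _ : T => v).
Proof. by move=> i; exact: measurable_cst. Qed.

Lemma vmeasurableD f g : vmeasurable f -> vmeasurable g ->
  vmeasurable (fun t => f t + g t).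
Proof.
move=> mf mg i; apply: (eq_measurable_fun (fun t => f t i 0 + g t i 0)).
  by move=> t _; rewrite mxE.
exact: measurable_funD.
Qed.

Lemma vmeasurableZ a f : vmeasurable f -> vmeasurable (fun t => a *: f t).
Proof.
move=> mf i; apply: (eq_measurable_fun (fun t => a * f t i 0)).
  by move=> t _; rewrite mxE.
exact: measurable_funM.
Qed.

Lemma vmeasurableB f g : vmeasurable f -> vmeasurable g ->
  vmeasurable (fun t => f t - g t).
Proof.
move=> mf mg; have := vmeasurableD mf (vmeasurableZ (-1) mg).
by under [X in vmeasurable X -> _]eq_fun do rewrite scaleN1r.
Qed.

Lemma vmeasurable_mulmx F f : mmeasurable F -> vmeasurable f ->
  vmeasurable (fun t => F t *m f t).
Proof.
move=> mF mf i; apply: (eq_measurable_fun (fun t => \sum_j F t i j * f t j 0)).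
  by move=> t _; rewrite mxE.
by apply: measurable_bigsum => j; apply: measurable_funM.
Qed.

Lemma mmeasurable_cst M : mmeasurable (fun _ : T => M).
Proof. by move=> i j; exact: measurable_cst. Qed.

Lemma vmeasurable_sum (I : Type) (s : seq I) (h : I -> T -> 'cV[R]_d) :
  (forall i, vmeasurable (h i)) -> vmeasurable (fun t => \sum_(i <- s) h i t).
Proof.
move=> mh j; apply: (eq_measurable_fun (fun t => \sum_(i <- s) h i t j 0)).
  by move=> t _; rewrite summxE.
by apply: measurable_bigsum => i; exact: mh.
Qed.

Lemma vmeasurable_comp (phi : T' -> T) f : measurable_fun setT phi ->
  vmeasurable f -> vmeasurable (fun t => f (phi t)).
Proof. by move=> mphi mf i; exact: (measurableT_comp (mf i) mphi). Qed.

Lemma mmeasurable_comp (phi : T' -> T) F : measurable_fun setT phi ->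
  mmeasurable F -> mmeasurable (fun t => F (phi t)).
Proof. by move=> mphi mF i j; exact: (measurableT_comp (mF i j) mphi). Qed.

Lemma measurable_form Q f g : vmeasurable f -> vmeasurable g ->
  measurable_fun setT (fun t => form Q (f t) (g t)).
Proof.
move=> mf mg.
apply: (eq_measurable_fun (fun t => \sum_j \sum_i f t i 0 * Q i j * g t j 0)).
  by move=> t _; rewrite form_sum.
apply: measurable_bigsum => j; apply: measurable_bigsum => i.
by apply: measurable_funM => //; apply: measurable_funM.
Qed.

Lemma measurable_sqr_vnorm f : vmeasurable f ->
  measurable_fun setT (fun t => vnorm (f t) ^+ 2).
Proof.
move=> mf; apply: (eq_measurable_fun (fun t => form 1%:M (f t) (f t))).
  by move=> t _; rewrite sqr_vnorm.
exact: measurable_form.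
Qed.

Lemma measurable_vnorm f : vmeasurable f -> measurable_fun setT (fun t => vnorm (f t)).
Proof.
move=> mf; apply: (eq_measurable_fun (fun t => (vnorm (f t) ^+ 2) `^ 2^-1)).
  by move=> t _; rewrite powR12_sqrt ?sqr_ge0// sqrtr_sqr ger0_norm ?vnorm_ge0.
exact: (measurableT_comp (@measurable_powR R 2^-1) (measurable_sqr_vnorm mf)).
Qed.

End MeasurableVectors.

(** * Integrable functions of mean zero *)

Section Centered.
Context {R : realType} {dZ : measure_display} {Zt : measurableType dZ}.
Variable pi : probability Zt R.
Implicit Types c : Zt -> R.

Definition centered c :=
  pi.-integrable setT (EFin \o c) /\ (\int[pi]_z (c z)%:E = 0)%E.

Lemma eq_centered c c' : c =1 c' -> centered c -> centered c'.
Proof. by move=> /funext ->. Qed.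

Lemma centeredD c c' : centered c -> centered c' -> centered (fun z => c z + c' z).
Proof.
move=> [i1 e1] [i2 e2]; split; first exact: (integrableD measurableT i1 i2).
by under eq_integral do rewrite EFinD; rewrite integralD// e1 e2 adde0.
Qed.

Lemma centeredZ a c : centered c -> centered (fun z => a * c z).
Proof.
move=> [i1 e1]; split; first exact: (integrableZl measurableT a i1).
by under eq_integral do rewrite EFinM; rewrite integralZl// e1 mule0.
Qed.

Lemma centered0 : centered (fun=> 0).
Proof. by split; [exact: integrable0|rewrite integral0]. Qed.

Lemma centered_sum (I : Type) (s : seq I) (h : I -> Zt -> R) :
  (forall i, centered (h i)) -> centered (fun z => \sum_(i <- s) h i z).
Proof.
move=> ch; elim: s => [|i s IH].
  by apply: eq_centered centered0 => z; rewrite big_nil.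
by apply: eq_centered (centeredD (ch i) IH) => z; rewrite big_cons.
Qed.

Lemma centered_sub_mean c : pi.-integrable setT (EFin \o c) ->
  centered (fun z => c z - \int[pi]_z (c z)).
Proof.
move=> ic; split.
  apply: (eq_integrable _ (fun z => (c z)%:E - (\int[pi]_z (c z))%:E)%E) => //.
    by apply: integrableB => //; exact: finite_measure_integrable_cst.
under eq_integral do rewrite EFinB.
rewrite integralB//; last exact: finite_measure_integrable_cst.
have -> : (\int[pi]_z ((\int[pi]_z (c z))%R%:E) = (\int[pi]_z (c z))%R%:E)%E.
  by rewrite integral_cst// [X in (_ * X)%E]probability_setT mule1.
by rewrite /Rintegral fineK ?subee// integrable_fin_num.
Qed.

(** Here the correction [beta * c] of the pointwise inequalities disappears. As f is nonnegative,
    monotonicity applies without knowing beforehand that f is integrable. *)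
Lemma integral_le_centered (f : Zt -> R) c (W : R) : measurable_fun setT f ->
  (forall z, 0 <= f z) -> centered c -> (forall z, f z <= W + c z) ->
  (\int[pi]_z (f z)%:E <= W%:E)%E.
Proof.
move=> mf f0 [ic ec] fle.
apply: (@le_trans _ _ (\int[pi]_z (W%:E + (c z)%:E))%E).
  apply: ge0_le_integral => //.
  - by move=> z _; rewrite lee_fin.
  - exact/measurable_EFinP.
  - apply: emeasurable_funD => //; exact: measurable_int ic.
  - by move=> z _; rewrite -EFinD lee_fin.
rewrite integralD//; last exact: finite_measure_integrable_cst.
by rewrite ec adde0 integral_cst// [X in (_ * X)%E]probability_setT mule1.
Qed.

Section Vectors.
Context {d : nat}.

Implicit Types f g : Zt -> 'cV[R]_d.

Definition vcentered f := forall i, centered (fun z => f z i 0).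

Lemma vcenteredD f g : vcentered f -> vcentered g -> vcentered (fun z => f z + g z).
Proof.
by move=> cf cg i; apply: eq_centered (centeredD (cf i) (cg i)) => z; rewrite mxE.
Qed.

Lemma vcentered_mulmx (F : Zt -> 'M[R]_d) x :
  (forall i j, centered (fun z => F z i j)) -> vcentered (fun z => F z *m x).
Proof.
move=> cF i; apply: (@eq_centered (fun z => \sum_j x j 0 * F z i j)).
  by move=> z; rewrite mxE; apply: eq_bigr => j _; rewrite mulrC.
by apply: centered_sum => j; exact: centeredZ.
Qed.

Lemma centered_form Q u f : vcentered f -> centered (fun z => form Q u (f z)).
Proof.
move=> cf; apply: (@eq_centered (fun z => \sum_j \sum_i (u i 0 * Q i j) * f z j 0)).
  by move=> z; rewrite form_sum.
by apply: centered_sum => j; apply: centered_sum => i; exact: centeredZ.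
Qed.

End Vectors.
End Centered.

(** * Bounds in L^p and their calculus *)

Section LpBound.
Context {R : realType} {dO : measure_display} {Om : measurableType dO}.
Variables (P : probability Om R) (p : R).
Hypothesis p2 : 2 <= p.
Implicit Types (X Y : Om -> R) (c : R).

(** Bundling measurability and the sign of the bound makes the notion closed under sums, nonnegative
    scaling and domination with no side conditions to repeat. *)
Definition Lp_bound X c :=
  [/\ measurable_fun setT X, 0 <= c & ('N[P]_p%:E[EFin \o X] <= c%:E)%E].

Let p_gt0 : 0 < p. Proof. by rewrite (lt_le_trans _ p2). Qed.

Lemma Lnorm_leP X c : 0 <= c ->
  ('N[P]_p%:E[EFin \o X] <= c%:E)%E <->
  (\int[P]_w (`|X w| `^ p)%:E <= (c `^ p)%:E)%E.
Proof.
move=> c0.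
have -> : (\int[P]_w (`|X w| `^ p)%:E = 'N[P]_p%:E[EFin \o X] `^ p)%E.
  by rewrite poweR_Lnorm ?gt_eqF//; apply: eq_integral => w _; rewrite poweR_EFin.
rewrite -poweR_EFin; split => h.
  by apply: (gt0_ler_poweR (ltW p_gt0)) => //; rewrite in_itv/= leey andbT ?Lnorm_ge0 ?lee_fin.
have := @gt0_ler_poweR R p^-1 _ _ _ _ _ h.
rewrite -!poweRrM mulfV ?gt_eqF// !poweRe1 ?Lnorm_ge0 ?lee_fin//; apply.
- by rewrite invr_ge0 ltW.
- by rewrite in_itv/= poweR_ge0 leey.
- by rewrite in_itv/= leey andbT lee_fin powR_ge0.
Qed.

Lemma Lp_bound_moment X c : measurable_fun setT X -> (forall w, 0 <= X w) -> 0 <= c ->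
  (\int[P]_w ((X w ^+ 2) `^ (p / 2))%:E <= ((c ^+ 2) `^ (p / 2))%:E)%E -> Lp_bound X c.
Proof.
move=> mX X0 c0 h; split => //; apply/(Lnorm_leP _ c0).
rewrite -(@powR_square R c p c0); apply: le_trans h; apply: ge0_le_integral => //.
- apply/measurable_EFinP; apply: (measurableT_comp (@measurable_powR R p)).
  exact: measurableT_comp.
- apply/measurable_EFinP; apply: (measurableT_comp (@measurable_powR R (p / 2))).
  exact: measurable_funX.
- by move=> w _; rewrite lee_fin powR_square// ger0_norm.
Qed.

Lemma Lp_boundD X Y c c' : Lp_bound X c -> Lp_bound Y c' ->
  Lp_bound (fun w => X w + Y w) (c + c').
Proof.
move=> [mX c0 hX] [mY c0' hY]; split; [exact: measurable_funD|exact: addr_ge0|].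
apply: (le_trans (minkowski_EFin _ mX mY _)); first by rewrite (le_trans _ p2)// ler1n.
by rewrite EFinD leeD.
Qed.

Lemma Lp_bound_le X Y c c' : measurable_fun setT X -> (forall w, `|X w| <= Y w) ->
  c <= c' -> Lp_bound Y c -> Lp_bound X c'.
Proof.
move=> mX XY cc' [mY c0 hY]; have c0' := le_trans c0 cc'; split => //.
move/(Lnorm_leP _ c0) : hY => hY; apply/(Lnorm_leP _ c0').
apply: (@le_trans _ _ (c `^ p)%:E); last first.
  by rewrite lee_fin ler_powRl// ltW.
apply: le_trans hY; apply: ge0_le_integral => //.
- apply/measurable_EFinP; apply: (measurableT_comp (@measurable_powR R p)).
  exact: measurableT_comp.
- apply/measurable_EFinP; apply: (measurableT_comp (@measurable_powR R p)).
  exact: measurableT_comp.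
- move=> w _; rewrite lee_fin ler_powRl ?(ltW p_gt0)//.
  by rewrite (le_trans (XY w))// ler_norm.
Qed.

Lemma Lp_boundZ a X c : 0 <= a -> Lp_bound X c -> Lp_bound (fun w => a * X w) (a * c).
Proof.
move=> a0 [mX c0 hX]; split; [exact: measurable_funM|exact: mulr_ge0|].
move/(Lnorm_leP _ c0) : hX => hX; apply/(Lnorm_leP _ (mulr_ge0 a0 c0)).
under eq_integral do rewrite normrM (ger0_norm a0) powRM// EFinM.
rewrite ge0_integralZl_EFin ?powR_ge0//; last first.
  apply/measurable_EFinP; apply: (measurableT_comp (@measurable_powR R p)).
  exact: measurableT_comp.
by rewrite powRM// EFinM lee_wpmul2l// lee_fin powR_ge0.
Qed.

Lemma Lp_bound0 : Lp_bound (fun=> 0) 0.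
Proof.
split => //; apply/Lnorm_leP => //.
under eq_integral do rewrite normr0 powR0 ?gt_eqF//.
by rewrite integral0 powR0 ?gt_eqF.
Qed.

Lemma Lp_bound_sum (I : Type) (s : seq I) (X : I -> Om -> R) (c : I -> R) :
  (forall i, Lp_bound (X i) (c i)) ->
  Lp_bound (fun w => \sum_(i <- s) X i w) (\sum_(i <- s) c i).
Proof.
move=> h; elim: s => [|i s IH].
  by rewrite big_nil; under eq_fun do rewrite big_nil; exact: Lp_bound0.
by rewrite big_cons; under eq_fun do rewrite big_cons; exact: Lp_boundD.
Qed.

End LpBound.

Ltac nonneg := repeat first
  [ assumption | (apply: ltW; assumption) | apply: sqr_ge0 | apply: vnorm_ge0
  | apply: addr_ge0 | apply: mulr_ge0 | rewrite invr_ge0 | apply: sumr_ge0 => ? _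
  | match goal with H : forall x, is_true (0 <= _) |- _ => apply: H end | done ].

(** * The joint energy of martingale and state, for a general centred forcing b *)

Section Recursion.
Context {R : realType} {dZ dO : measure_display}.
Context {Zt : measurableType dZ} {Om : measurableType dO}.
Variables (pi : probability Zt R) (P : probability Om R) (Z : nat -> Om -> Zt).
Hypothesis iidZ : iid_seq pi P Z.
Context {d : nat}.
Variables (A : Zt -> 'M[R]_d) (Abar : 'M[R]_d) (b : Zt -> 'cV[R]_d) (Q : 'M[R]_d).
Variables (CA M lmin lmax a alpha p K : R) (x0 : 'cV[R]_d).
Let At z := A z - Abar.
Hypotheses (mA : mmeasurable A) (mb : vmeasurable b).
Hypotheses (cA : forall i j, centered pi (fun z => At z i j)) (cb : vcentered pi b).
Hypotheses (At_le : forall z x, vnorm (At z *m x) <= CA * vnorm x).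
Hypotheses (b_le : forall z, vnorm (b z) <= M) (CA0 : 0 <= CA).
Hypotheses (QT : symmetric_mx Q) (Q0 : forall x, 0 <= form Q x x).
Hypotheses (lmin0 : 0 < lmin) (lmax0 : 0 <= lmax).
Hypotheses (le_lmin : forall x, lmin * vnorm x ^+ 2 <= form Q x x).
Hypotheses (le_lmax : forall x, form Q x x <= lmax * vnorm x ^+ 2).
Hypothesis contraction : forall x, form Q (x - alpha *: (Abar *m x)) (x - alpha *: (Abar *m x))
  <= (1 - alpha * a) * form Q x x.
Hypotheses (K0 : 0 <= K) (p2 : 2 <= p).
Hypothesis two_pointK : forall S T : R, 0 <= S -> 0 <= T -> exists beta, forall c v,
  c ^+ 2 <= S * T -> 0 <= v -> v <= S + 2 * c + T ->
  v `^ (p / 2) <= (S + K * T) `^ (p / 2) + beta * c.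

(** [c0] is the additive noise of one step in Q-energy, [rho] the contraction plus the
    multiplicative noise, and [L] the cost of a martingale increment per unit of Q-energy. Each
    noise carries the factor K; the factors 2 come from splitting [At z *m x - b z]. *)
Let c0 := 2 * K * alpha ^+ 2 * lmax * M ^+ 2.
Let rho := 1 - alpha * a + 2 * K * alpha ^+ 2 * (lmax / lmin) * CA ^+ 2.
Let L := K * CA ^+ 2 / lmin.

Let p20 : 0 <= p / 2. Proof. by rewrite divr_ge0// (le_trans _ p2). Qed.

Lemma energy_expansion (B g t : R) (m y n h : 'cV[R]_d) :
  B + vnorm (m + t *: h) ^+ 2 + g * form Q (y - alpha *: n) (y - alpha *: n) =
  (B + vnorm m ^+ 2 + g * form Q y y)
  + 2 * (t * form 1%:M m h + - (g * alpha) * form Q y n)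
  + (t ^+ 2 * vnorm h ^+ 2 + g * alpha ^+ 2 * form Q n n).
Proof.
rewrite !sqr_vnorm !(formDl, formDr, formNl, formNr, formZl, formZr).
rewrite (form_sym h m (@symmetric_mx1 R d)) (form_sym n y QT).
ring.
Qed.

(** Cauchy-Schwarz in the product of two copies of the space, with the Euclidean form on the first
    and g times Q on the second, for the pairs [(m, y)] and [(t *: h, - alpha *: n)]. *)
Lemma energy_cauchy_schwarz (g t : R) (m y n h : 'cV[R]_d) : 0 <= g ->
  (t * form 1%:M m h + - (g * alpha) * form Q y n) ^+ 2 <=
  (vnorm m ^+ 2 + g * form Q y y) * (t ^+ 2 * vnorm h ^+ 2 + g * alpha ^+ 2 * form Q n n).
Proof.
move=> g0; apply: discriminant_le0 => s u.
have : 0 <= vnorm (s *: m + (u * t) *: h) ^+ 2 +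
    g * form Q (s *: y - (u * alpha) *: n) (s *: y - (u * alpha) *: n) by nonneg.
rewrite !sqr_vnorm !(formDl, formDr, formNl, formNr, formZl, formZr).
rewrite (form_sym h m (@symmetric_mx1 R d)) (form_sym n y QT); lra.
Qed.

Lemma inner_step (B g t : R) (m x : 'cV[R]_d) : 0 <= B -> 0 <= g ->
  (\int[pi]_z ((B + vnorm (m + t *: (At z *m x)) ^+ 2 +
     g * form Q (x - alpha *: (A z *m x - b z)) (x - alpha *: (A z *m x - b z)))
       `^ (p / 2))%:E <=
   ((B + g * c0 + vnorm m ^+ 2 + (g * rho + L * t ^+ 2) * form Q x x) `^ (p / 2))%:E)%E.
Proof.
move=> B0 g0.
(* [y] is the mean of the updated state; the deviation [- alpha *: (At z *m x - b z)] is centred. *)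
pose y := x - alpha *: (Abar *m x).
pose S := B + vnorm m ^+ 2 + g * form Q y y.
pose N2 := 2 * CA ^+ 2 * vnorm x ^+ 2 + 2 * M ^+ 2.
(* Free of z by design, so that the slope [beta] is a constant and [beta * c z] is centred. *)
pose T := t ^+ 2 * (CA ^+ 2 * vnorm x ^+ 2) + g * alpha ^+ 2 * (lmax * N2).
have S0 : 0 <= S by rewrite /S; nonneg.
have T0 : 0 <= T.
  by rewrite /T /N2; nonneg.
have [beta Hbeta] := two_pointK S0 T0.
pose c z := t * form 1%:M m (At z *m x) + - (g * alpha) * form Q y (At z *m x - b z).
have xE z : x - alpha *: (A z *m x - b z) = y - alpha *: (At z *m x - b z).
  rewrite /y /At mulmxBl !scalerBr; set u := alpha *: (A z *m x).
  set v := alpha *: (Abar *m x); set w := alpha *: b z.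
  by apply/colP => i; rewrite !mxE; ring.
have hx z : vnorm (At z *m x) ^+ 2 <= CA ^+ 2 * vnorm x ^+ 2.
  by rewrite -exprMn ler_pXn2r ?nnegrE ?mulr_ge0 ?vnorm_ge0.
have hn z : form Q (At z *m x - b z) (At z *m x - b z) <= lmax * N2.
  apply: (le_trans (le_lmax _)); rewrite ler_wpM2l//.
  have h1 := vnormD (At z *m x) (- b z); rewrite vnormN in h1.
  have h2 := hx z.
  have h3 : vnorm (b z) ^+ 2 <= M ^+ 2.
    by rewrite ler_pXn2r ?nnegrE ?vnorm_ge0// (le_trans (vnorm_ge0 (b z))).
  have h4 : vnorm (At z *m x - b z) ^+ 2 <= (vnorm (At z *m x) + vnorm (b z)) ^+ 2.
    by rewrite ler_pXn2r ?nnegrE ?addr_ge0 ?vnorm_ge0.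
  have h5 := sqr_ge0 (vnorm (At z *m x) - vnorm (b z)).
  by rewrite /N2; lra.
apply: (@le_trans _ _ ((S + K * T) `^ (p / 2))%:E).
  apply: (@integral_le_centered _ _ _ pi _ (fun z => beta * c z)).
  - apply: (measurableT_comp (@measurable_powR R (p / 2))).
    have mAx : vmeasurable (fun z => A z *m x).
      by apply: vmeasurable_mulmx => //; exact: vmeasurable_cst.
    have mAt : vmeasurable (fun z => At z *m x).
      apply: vmeasurable_mulmx; last exact: vmeasurable_cst.
      move=> i j; apply: (eq_measurable_fun (fun z => A z i j - Abar i j)).
        by move=> z _; rewrite !mxE.
      exact: measurable_funB.
    apply: measurable_funD; first apply: measurable_funD => //.
      apply: measurable_sqr_vnorm; apply: vmeasurableD; first exact: vmeasurable_cst.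
      exact: vmeasurableZ.
    apply: measurable_funM => //.
    by apply: measurable_form; apply: vmeasurableB; rewrite ?[vmeasurable (fun=> x)]vmeasurable_cst//;
      solve [exact: vmeasurable_cst|apply: vmeasurableZ; exact: vmeasurableB].
  - by move=> z; exact: powR_ge0.
  - apply: centeredZ; apply: centeredD; apply: centeredZ; apply: centered_form.
      exact: vcentered_mulmx.
    apply: vcenteredD; first exact: vcentered_mulmx.
    move=> i; apply: eq_centered (centeredZ (-1) (cb i)) => z.
    by rewrite !mxE mulN1r.
  - move=> z; apply: Hbeta.
    + apply: (le_trans (energy_cauchy_schwarz _ _ _ _ _ g0)).
      apply: ler_pM; [by nonneg|by nonneg| |].
        by rewrite /S -addrA lerDr.
      rewrite /T lerD//; first by rewrite ler_wpM2l//; nonneg.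
      by rewrite ler_wpM2l//; nonneg.
    + by nonneg.
    + rewrite xE energy_expansion -/S -/(c z) // lerD2l lerD//.
        by rewrite ler_wpM2l//; nonneg.
      by rewrite ler_wpM2l//; nonneg.
rewrite lee_fin; apply: ler_powRl => //.
  by nonneg.
have j1 := ler_wpM2l g0 (contraction x); rewrite -/y in j1.
(* Exchanges the Euclidean noise bounds for Q-energy at the rate [1 / lmin], the only quantity the
   recursion tracks. *)
have j2 : 0 <= (K * t ^+ 2 * CA ^+ 2 + 2 * g * K * alpha ^+ 2 * lmax * CA ^+ 2) *
    (form Q x x / lmin - vnorm x ^+ 2).
  rewrite mulr_ge0//; last by rewrite subr_ge0 ler_pdivlMr// mulrC.
  by nonneg.
rewrite /S /T /N2 /L /rho /c0; lra.
Qed.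

Definition noise_sum (x : nat -> Om -> 'cV[R]_d) (tau : nat -> R) (k : nat) (w : Om) :=
  \sum_(0 <= j < k) tau j *: (At (Z j.+1 w) *m x j w).

Let x := lsa A b Z alpha x0.

Lemma lsa_vmeasurable k : vmeasurable (x k : past Z k -> _).
Proof.
elim: k => [|k IH]; first exact: vmeasurable_cst.
have IH' : vmeasurable (x k : past Z k.+1 -> _).
  by move=> i; exact: (past_widen (leqnSn k) (IH i)).
have mZ : measurable_fun setT (Z k.+1 : past Z k.+1 -> Zt).
  by apply: measurable_past_sample; rewrite ltnS leqnn.
rewrite /x /=; apply: vmeasurableB => //; apply: vmeasurableZ; apply: vmeasurableB.
  apply: vmeasurable_mulmx => //; exact: (mmeasurable_comp mZ mA).
exact: (vmeasurable_comp mZ mb).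
Qed.

Lemma mmeasurable_At : mmeasurable At.
Proof.
move=> i j; apply: (eq_measurable_fun (fun z => A z i j - Abar i j)).
  by move=> z _; rewrite !mxE.
exact: measurable_funB.
Qed.

Lemma noise_sum_vmeasurable tau k : vmeasurable (noise_sum x tau k : past Z k -> _).
Proof.
elim: k => [|k IH].
  rewrite /noise_sum => i; under eq_fun do rewrite big_geq// mxE; exact: measurable_cst.
have wid f : vmeasurable (f : past Z k -> 'cV[R]_d) -> vmeasurable (f : past Z k.+1 -> _).
  by move=> mf i; exact: (past_widen (leqnSn k) (mf i)).
have mZ : measurable_fun setT (Z k.+1 : past Z k.+1 -> Zt).
  by apply: measurable_past_sample; rewrite ltnS leqnn.
rewrite /noise_sum; under eq_fun do rewrite big_nat_recr//=.
apply: vmeasurableD; first exact: wid IH.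
apply: vmeasurableZ; apply: vmeasurable_mulmx; last by apply: wid; exact: lsa_vmeasurable.
exact: (mmeasurable_comp mZ mmeasurable_At).
Qed.

(** One step back in time replaces [(B, g)] by [(B + g * c0, g * rho + L * tau k ^+ 2)]. Any
    sequence u that is a supersolution of the scalar energy recursion then bounds the accumulated
    result. *)
Lemma moment_recursion (tau u : nat -> R) : 0 <= rho ->
  form Q x0 x0 <= u 0 -> (forall k, rho * u k + c0 <= u k.+1) ->
  forall k B g, 0 <= B -> 0 <= g ->
  (\int[P]_w ((B + vnorm (noise_sum x tau k w) ^+ 2 + g * form Q (x k w) (x k w))
     `^ (p / 2))%:E <=
   ((B + L * \sum_(0 <= j < k) tau j ^+ 2 * u j + g * u k) `^ (p / 2))%:E)%E.
Proof.
move=> rho0 u0 u_rec; elim=> [|k IH] B g B0 g0.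
  under eq_integral do rewrite /noise_sum big_geq// vnorm0 expr0n /= (_ : x 0 _ = x0)//.
  rewrite integral_cst// [X in (_ * X)%E]probability_setT mule1 lee_fin.
  rewrite big_geq// mulr0 !addr0; apply: ler_powRl => //.
    by nonneg.
  by rewrite lerD2l ler_wpM2l.
have c00 : 0 <= c0 by rewrite /c0; nonneg.
have L0 : 0 <= L by rewrite /L; nonneg.
pose Psi (q : past Z k * Zt) : \bar R :=
  ((B + vnorm (noise_sum x tau k q.1 + tau k *: (At q.2 *m x k q.1)) ^+ 2 +
    g * form Q (x k q.1 - alpha *: (A q.2 *m x k q.1 - b q.2))
               (x k q.1 - alpha *: (A q.2 *m x k q.1 - b q.2))) `^ (p / 2))%:E.
pose G (w : past Z k) : \bar R :=
  ((B + g * c0 + vnorm (noise_sum x tau k w) ^+ 2 +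
    (g * rho + L * tau k ^+ 2) * form Q (x k w) (x k w)) `^ (p / 2))%:E.
have -> : (\int[P]_w ((B + vnorm (noise_sum x tau k.+1 w) ^+ 2 +
     g * form Q (x k.+1 w) (x k.+1 w)) `^ (p / 2))%:E =
     \int[P]_w Psi (w, Z k.+1 w))%E.
  by apply: eq_integral => w _; rewrite /Psi /= {1}/noise_sum big_nat_recr.
have mx1 : vmeasurable (fun q : past Z k * Zt => x k q.1).
  exact (@vmeasurable_comp R d _ _ (past Z k) _ fst (x k) measurable_fst (@lsa_vmeasurable k)).
have mn1 : vmeasurable (fun q : past Z k * Zt => noise_sum x tau k q.1).
  exact (@vmeasurable_comp R d _ _ (past Z k) _ fst (noise_sum x tau k)
    measurable_fst (@noise_sum_vmeasurable tau k)).
have mA1 : mmeasurable (fun q : past Z k * Zt => A q.2).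
  exact (@mmeasurable_comp R d _ _ _ (past Z k * Zt)%type snd A measurable_snd mA).
have mAt1 : mmeasurable (fun q : past Z k * Zt => At q.2).
  exact (@mmeasurable_comp R d _ _ _ (past Z k * Zt)%type snd At measurable_snd mmeasurable_At).
have mb1 : vmeasurable (fun q : past Z k * Zt => b q.2).
  exact (@vmeasurable_comp R d _ _ _ (past Z k * Zt)%type snd b measurable_snd mb).
have mPsi : measurable_fun setT Psi.
  apply/measurable_EFinP; apply: (measurableT_comp (@measurable_powR R (p / 2))).
  apply: measurable_funD; first apply: measurable_funD => //.
    apply: measurable_sqr_vnorm; apply: vmeasurableD => //.
    by apply: vmeasurableZ; exact: vmeasurable_mulmx.
  apply: measurable_funM => //.
  by apply: measurable_form; apply: vmeasurableB => //; apply: vmeasurableZ;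
    apply: vmeasurableB => //; exact: vmeasurable_mulmx.
have mG : measurable_fun setT G.
  apply/measurable_EFinP; apply: (measurableT_comp (@measurable_powR R (p / 2))).
  apply: measurable_funD; first apply: measurable_funD => //.
    by apply: measurable_sqr_vnorm; exact: noise_sum_vmeasurable.
  by apply: measurable_funM => //; apply: measurable_form; exact: lsa_vmeasurable.
apply: (le_trans (fresh_sample_le iidZ mPsi _ mG _)).
- by move=> q; rewrite lee_fin powR_ge0.
- by move=> w; exact (inner_step (tau k) (noise_sum x tau k w) (x k w) B0 g0).
rewrite /G; under eq_integral do rewrite -addrA addrA.
apply: (le_trans (IH (B + g * c0) (g * rho + L * tau k ^+ 2) _ _)).
- by nonneg.
- by nonneg.
have u_ge0 j : 0 <= u j.
  elim: j => [|j IHj]; first exact: le_trans (Q0 _) u0.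
  by apply: le_trans (u_rec j); rewrite addr_ge0// mulr_ge0.
rewrite lee_fin; apply: ler_powRl => //.
  by nonneg.
rewrite [in leRHS]big_nat_recr//=.
by have := ler_wpM2l g0 (u_rec k); lra.
Qed.

Section LpBounds.
Variable u : nat -> R.
Hypotheses (rho0 : 0 <= rho) (u0 : form Q x0 x0 <= u 0).
Hypothesis u_rec : forall k, rho * u k + c0 <= u k.+1.

Let u_ge0 j : 0 <= u j.
Proof.
have c00 : 0 <= c0 by rewrite /c0; nonneg.
elim: j => [|j IHj]; first exact: le_trans (Q0 _) u0.
by apply: le_trans (u_rec j); nonneg.
Qed.

Let vx k : vmeasurable (x k).
Proof. by move=> i; exact (measurable_from_past iidZ (@lsa_vmeasurable k i)). Qed.

Let vn tau k : vmeasurable (noise_sum x tau k).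
Proof. by move=> i; exact (measurable_from_past iidZ (@noise_sum_vmeasurable tau k i)). Qed.

Let measurable_energy tau B g k : measurable_fun setT
  (fun w => ((B + vnorm (noise_sum x tau k w) ^+ 2 + g * form Q (x k w) (x k w)) `^ (p / 2))%:E).
Proof.
apply/measurable_EFinP; apply: (measurableT_comp (@measurable_powR R (p / 2))).
apply: measurable_funD; first by apply: measurable_funD => //; exact: measurable_sqr_vnorm.
by apply: measurable_funM => //; exact: measurable_form.
Qed.

Lemma Lp_bound_lsa k :
  Lp_bound P p (fun w => vnorm (x k w)) (Num.sqrt (u k / lmin)).
Proof.
have li : 0 <= lmin^-1 by rewrite invr_ge0 ltW.
apply: (Lp_bound_moment p2).
- exact: measurable_vnorm.
- by move=> w; exact: vnorm_ge0.
- exact: sqrtr_ge0.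
rewrite sqr_sqrtr; last by rewrite mulr_ge0.
(* Weight 0 switches the martingale off, and [g = lmin^-1] makes the Q-energy dominate the square
   norm. *)
have := moment_recursion (fun=> 0) rho0 u0 u_rec k (lexx 0) li.
rewrite big1 => [|j _]; last by rewrite expr0n mul0r.
rewrite mulr0 !add0r [lmin^-1 * _]mulrC; apply: le_trans.
apply: ge0_le_integral => //.
- by move=> w _; rewrite lee_fin powR_ge0.
- apply/measurable_EFinP; apply: (measurableT_comp (@measurable_powR R (p / 2))).
  exact: measurable_sqr_vnorm.
- move=> w _; rewrite lee_fin; apply: ler_powRl => //; first exact: sqr_ge0.
  rewrite add0r (@le_trans _ _ (lmin^-1 * form Q (x k w) (x k w)))//.
    by rewrite mulrC ler_pdivlMr// mulrC.
  by rewrite lerDr sqr_ge0.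
Qed.

Lemma Lp_bound_noise_sum tau k :
  Lp_bound P p (fun w => vnorm (noise_sum x tau k w))
    (Num.sqrt (L * \sum_(0 <= j < k) tau j ^+ 2 * u j)).
Proof.
apply: (Lp_bound_moment p2).
- exact: measurable_vnorm.
- by move=> w; exact: vnorm_ge0.
- exact: sqrtr_ge0.
have L0 : 0 <= L by rewrite /L; nonneg.
rewrite sqr_sqrtr; last by nonneg.
(* With [B = g = 0] the energy is the martingale alone; the state enters only through the earlier
   weights. *)
have := moment_recursion tau rho0 u0 u_rec k (lexx 0) (lexx 0).
rewrite add0r mul0r addr0; apply: le_trans.
apply: ge0_le_integral => //.
- by move=> w _; rewrite lee_fin powR_ge0.
- apply/measurable_EFinP; apply: (measurableT_comp (@measurable_powR R (p / 2))).
  exact: measurable_sqr_vnorm.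
- move=> w _; rewrite lee_fin add0r mul0r addr0; exact: lexx.
Qed.

End LpBounds.
End Recursion.

(** * A Rosenthal-type bound for i.i.d. sums *)

Section Rosenthal.
Context {R : realType}.

(** Compare with [(1 - y)^-1]: clearing the denominator leaves [y ^+ 2 * (3 - 4 * y) >= 0], whence
    the threshold 3/4. *)
Lemma expR_le_quadratic (y : R) : y <= 3 / 4 -> expR y <= 1 + y + 4 * y ^+ 2.
Proof.
move=> y34; have := expR_ge1Dx (- y); rewrite expRN => h.
have y1 : 0 < 1 - y by lra.
have h2 : expR y <= (1 - y)^-1.
  by rewrite -[expR y]invrK lef_pV2 ?posrE ?invr_gt0 ?expR_gt0.
apply: (le_trans h2); rewrite -div1r ler_pdivrMr//.
have : 0 <= y ^+ 2 * (3 - 4 * y) by rewrite mulr_ge0 ?sqr_ge0//; lra.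
by lra.
Qed.

Lemma powR1D_le_expR (u r : R) : 0 <= r -> 0 <= 1 + u -> (1 + u) `^ r <= expR (r * u).
Proof.
move=> r0 u0; rewrite mulrC expRM; apply: ler_powRl => //; exact: expR_ge1Dx.
Qed.

Context {d : nat}.

(** Factor out Y and write the new energy as [Y * (1 + u)]; its power is at most that of Y times
    [expR (p / 2 * u)], and [p ^+ 2 * M ^+ 2 <= B] keeps the exponent below 3/4, so a quadratic
    bound applies. Since [u ^+ 2 <= 8 * n2 / Y], second order costs [8 * p ^+ 2 * n2] beside the
    first-order [p / 2 * n2]: together [p / 2 * (1 + 16 * p) * n2]. The last bracket is centred in e
    when s2 is the mean of n2. *)
Lemma rosenthal_pointwise (p B M s2 Y : R) (s e : 'cV[R]_d) : 2 <= p ->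
  p ^+ 2 * M ^+ 2 <= B -> vnorm e <= M -> Y = B + vnorm s ^+ 2 ->
  (B + vnorm (s + e) ^+ 2) `^ (p / 2) <=
  (Y `^ (p / 2) + (p / 2) * ((1 + 16 * p) * s2) * Y `^ (p / 2 - 1))
  + (p * Y `^ (p / 2 - 1) * form 1%:M s e +
     (p / 2) * (1 + 16 * p) * Y `^ (p / 2 - 1) * (vnorm e ^+ 2 - s2)).
Proof.
move=> p2 BM eM YE.
have M0 : 0 <= M := le_trans (vnorm_ge0 e) eM.
have B0 : 0 <= B by apply: le_trans BM; rewrite mulr_ge0 ?sqr_ge0.
have Y0 : 0 <= Y by rewrite YE addr_ge0 ?sqr_ge0.
have cs := dot_cauchy_schwarz s e.
have expand : B + vnorm (s + e) ^+ 2 = Y + 2 * form 1%:M s e + vnorm e ^+ 2.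
  rewrite YE !sqr_vnorm formDl !formDr (form_sym e s (@symmetric_mx1 R d)); ring.
set c := form 1%:M s e in cs expand *.
set n2 := vnorm e ^+ 2 in cs expand *.
have n20 : 0 <= n2 by exact: sqr_ge0.
have n2M : n2 <= M ^+ 2 by rewrite ler_pXn2r ?nnegrE ?vnorm_ge0.
suff : (B + vnorm (s + e) ^+ 2) `^ (p / 2) <=
    Y `^ (p / 2) + Y `^ (p / 2 - 1) * (p / 2 * (2 * c + n2) + 8 * p ^+ 2 * n2) by lra.
have r0 : 0 <= p / 2 by lra.
have [Yz|Yn0] := eqVneq Y 0.
  have sq0 := sqr_ge0 (vnorm s).
  have s0 : vnorm s ^+ 2 = 0 by move: Yz; rewrite YE; lra.
  have Bz : B = 0 by move: Yz; rewrite YE; lra.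
  have n2z : n2 = 0.
    have : p ^+ 2 * M ^+ 2 <= 0 by rewrite -Bz.
    have : M ^+ 2 <= p ^+ 2 * M ^+ 2 by rewrite ler_peMl ?sqr_ge0//; nra.
    by lra.
  have cz : c = 0 by apply/eqP; rewrite -sqrf_eq0 eq_le sqr_ge0 andbT (le_trans cs)// s0 mul0r.
  have -> : p / 2 * (2 * c + n2) + 8 * p ^+ 2 * n2 = 0 by rewrite cz n2z; ring.
  by rewrite expand cz n2z !mulr0 !addr0.
have Ygt0 : 0 < Y by rewrite lt_def Yn0.
pose u := (2 * c + n2) / Y.
have uE : B + vnorm (s + e) ^+ 2 = Y * (1 + u) by rewrite expand /u; field.
have u0 : 0 <= 1 + u.
  by rewrite -(pmulr_rge0 _ Ygt0) -uE addr_ge0 ?sqr_ge0.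
have csM : c <= (p ^+ 2 * M ^+ 2 + vnorm s ^+ 2) / (2 * p).
  rewrite ler_pdivlMr; last lra.
  have h1 : c <= vnorm s * M.
    apply: (le_trans (ler_norm _)); apply: (le_trans (dot_le_vnorm s e)).
    by rewrite ler_wpM2l ?vnorm_ge0.
  have h2 := sqr_ge0 (p * M - vnorm s).
  have h3 : p * c <= p * (vnorm s * M) by rewrite ler_wpM2l//; lra.
  by lra.
(* The cross term contributes at most 1/2, by the arithmetic-geometric mean inequality for [p * M]
   and [vnorm s]; the square term at most 1/4, because [2 * p <= p ^+ 2]. *)
have small : p / 2 * u <= 3 / 4.
  rewrite /u mulrA ler_pdivrMr//.
  have k1 : p * c <= (p ^+ 2 * M ^+ 2 + vnorm s ^+ 2) / 2.
    have := csM; rewrite ler_pdivlMr; last lra.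
    by rewrite ler_pdivlMr//; lra.
  have k2 : p * n2 <= p * M ^+ 2 by rewrite ler_wpM2l//; lra.
  have k3 : 2 * p * M ^+ 2 <= p ^+ 2 * M ^+ 2 by rewrite ler_wpM2r ?sqr_ge0//; nra.
  have k4 : vnorm s ^+ 2 = Y - B by rewrite YE; ring.
  have k5 := sqr_ge0 (vnorm s).
  lra.
have u2 : u ^+ 2 <= 8 * n2 / Y.
  rewrite /u expr_div_n ler_pdivrMr ?exprn_gt0//.
  have -> : 8 * n2 / Y * Y ^+ 2 = 8 * (n2 * Y) by field.
  have h1 := sqr_ge0 (2 * c - n2).
  have h2 : n2 * n2 <= n2 * M ^+ 2 by rewrite ler_wpM2l.
  have h3 : n2 * (p ^+ 2 * M ^+ 2 + vnorm s ^+ 2) <= n2 * Y.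
    by rewrite ler_wpM2l// YE lerD2r.
  have h4 : n2 * M ^+ 2 <= n2 * (p ^+ 2 * M ^+ 2).
    by rewrite ler_wpM2l// ler_peMl ?sqr_ge0//; nra.
  have h5 : 0 <= n2 * M ^+ 2 by rewrite mulr_ge0 ?sqr_ge0.
  lra.
rewrite uE powRM// -(mulr_powRB1 Y0); last lra.
have -> : Y * Y `^ (p / 2 - 1) + Y `^ (p / 2 - 1) * (p / 2 * (2 * c + n2) + 8 * p ^+ 2 * n2) =
  Y * Y `^ (p / 2 - 1) * (1 + p / 2 * u + p ^+ 2 * (8 * n2 / Y)) by rewrite /u; field.
rewrite ler_wpM2l//; first by rewrite mulr_ge0// powR_ge0.
apply: (le_trans (powR1D_le_expR r0 u0)); apply: (le_trans (expR_le_quadratic small)).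
have : p ^+ 2 * u ^+ 2 <= p ^+ 2 * (8 * n2 / Y) by rewrite ler_wpM2l ?sqr_ge0.
by lra.
Qed.

Context {dZ dO : measure_display}.
Context {Zt : measurableType dZ} {Om : measurableType dO}.
Variables (pi : probability Zt R) (P : probability Om R) (Z : nat -> Om -> Zt).
Hypothesis iidZ : iid_seq pi P Z.
Variables (e : Zt -> 'cV[R]_d) (M s2 p : R).
Hypotheses (me : vmeasurable e) (ce : vcentered pi e) (e_le : forall z, vnorm (e z) <= M).
Hypotheses (ce2 : centered pi (fun z => vnorm (e z) ^+ 2 - s2)) (p2 : 2 <= p) (s20 : 0 <= s2).

Definition fresh_sum (k : nat) (w : Om) : 'cV[R]_d := \sum_(0 <= j < k) e (Z j.+1 w).

Lemma fresh_sum_vmeasurable k : vmeasurable (fresh_sum k : past Z k -> _).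
Proof.
elim: k => [|k IH].
  by rewrite /fresh_sum => i; under eq_fun do rewrite big_geq// mxE; exact: measurable_cst.
have IH' : vmeasurable (fresh_sum k : past Z k.+1 -> _).
  by move=> i; exact: (past_widen (leqnSn k) (IH i)).
have mZ : measurable_fun setT (Z k.+1 : past Z k.+1 -> Zt).
  by apply: measurable_past_sample; rewrite ltnS leqnn.
rewrite /fresh_sum; under eq_fun do rewrite big_nat_recr//=.
apply: vmeasurableD => //; exact (@vmeasurable_comp R d _ _ _ (past Z k.+1) (Z k.+1) e mZ me).
Qed.

Lemma rosenthal_moment k B : p ^+ 2 * M ^+ 2 <= B ->
  (\int[P]_w ((B + vnorm (fresh_sum k w) ^+ 2) `^ (p / 2))%:E <=
   ((B + k%:R * ((1 + 16 * p) * s2)) `^ (p / 2))%:E)%E.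
Proof.
have p0 : 0 <= p by rewrite (le_trans _ p2).
have p20 : 0 <= p / 2 by rewrite divr_ge0.
elim: k B => [|k IH] B BM.
  under eq_integral do rewrite /fresh_sum big_geq// vnorm0 expr0n /= addr0.
  by rewrite integral_cst// [X in (_ * X)%E]probability_setT mule1 lee_fin mul0r addr0.
have B0 : 0 <= B by apply: le_trans BM; rewrite mulr_ge0 ?sqr_ge0.
have v0 : 0 <= (1 + 16 * p) * s2 by rewrite mulr_ge0// addr_ge0// mulr_ge0.
pose Psi (q : past Z k * Zt) : \bar R :=
  ((B + vnorm (fresh_sum k q.1 + e q.2) ^+ 2) `^ (p / 2))%:E.
pose G (w : past Z k) : \bar R :=
  ((B + (1 + 16 * p) * s2 + vnorm (fresh_sum k w) ^+ 2) `^ (p / 2))%:E.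
have -> : (\int[P]_w ((B + vnorm (fresh_sum k.+1 w) ^+ 2) `^ (p / 2))%:E =
     \int[P]_w Psi (w, Z k.+1 w))%E.
  by apply: eq_integral => w _; rewrite /Psi /= {1}/fresh_sum big_nat_recr.
have mn1 : vmeasurable (fun q : past Z k * Zt => fresh_sum k q.1).
  exact (@vmeasurable_comp R d _ _ (past Z k) _ fst (fresh_sum k)
    measurable_fst (@fresh_sum_vmeasurable k)).
have me1 : vmeasurable (fun q : past Z k * Zt => e q.2).
  exact (@vmeasurable_comp R d _ _ _ (past Z k * Zt)%type snd e measurable_snd me).
have mPsi : measurable_fun setT Psi.
  apply/measurable_EFinP; apply: (measurableT_comp (@measurable_powR R (p / 2))).
  by apply: measurable_funD => //; apply: measurable_sqr_vnorm; exact: vmeasurableD.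
have mG : measurable_fun setT G.
  apply/measurable_EFinP; apply: (measurableT_comp (@measurable_powR R (p / 2))).
  by apply: measurable_funD => //; apply: measurable_sqr_vnorm; exact: fresh_sum_vmeasurable.
apply: (le_trans (fresh_sample_le iidZ mPsi _ mG _)).
- by move=> q; rewrite lee_fin powR_ge0.
- move=> w; rewrite /Psi /G /=; set s := fresh_sum k w; set Y := B + vnorm s ^+ 2.
  have Y0 : 0 <= Y by rewrite addr_ge0 ?sqr_ge0.
  apply: (@le_trans _ _ (Y `^ (p / 2) + (p / 2) * ((1 + 16 * p) * s2) * Y `^ (p / 2 - 1))%:E).
    apply: (@integral_le_centered _ _ _ pi _ (fun z => p * Y `^ (p / 2 - 1) * form 1%:M s (e z) +
     (p / 2) * (1 + 16 * p) * Y `^ (p / 2 - 1) * (vnorm (e z) ^+ 2 - s2))).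
    + apply: (measurableT_comp (@measurable_powR R (p / 2))).
      apply: measurable_funD => //; apply: measurable_sqr_vnorm; exact: vmeasurableD.
    + by move=> z; exact: powR_ge0.
    + by apply: centeredD; apply: centeredZ => //; exact: centered_form.
    + by move=> z; exact: (rosenthal_pointwise s2 p2 BM (e_le z) erefl).
  (* The averaged expansion is absorbed by raising B, which preserves the lower bound on B required
     by the induction. *)
  rewrite lee_fin; have := @bernoulli_homogeneous _ Y ((1 + 16 * p) * s2) (p / 2) Y0 v0.
  by rewrite /Y addrAC; apply; rewrite ler_pdivlMr// mul1r.
apply: (le_trans (IH _ _)); first by apply: (le_trans BM); rewrite lerDl.
rewrite lee_fin -[k.+1%:R]natr1.
have -> // : B + (k%:R + 1) * ((1 + 16 * p) * s2) =
  B + (1 + 16 * p) * s2 + k%:R * ((1 + 16 * p) * s2) by ring.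
Qed.

Lemma Lp_bound_fresh_sum k :
  Lp_bound P p (fun w => vnorm (fresh_sum k w))
    (Num.sqrt (p ^+ 2 * M ^+ 2 + k%:R * ((1 + 16 * p) * s2))).
Proof.
have p0 : 0 <= p by rewrite (le_trans _ p2).
have v0 : 0 <= (1 + 16 * p) * s2 by rewrite mulr_ge0// addr_ge0// mulr_ge0.
have B0 : 0 <= p ^+ 2 * M ^+ 2 by rewrite mulr_ge0 ?sqr_ge0.
have mS : vmeasurable (fresh_sum k).
  by move=> i; exact (measurable_from_past iidZ (@fresh_sum_vmeasurable k i)).
apply: (Lp_bound_moment p2).
- exact: measurable_vnorm.
- by move=> w; exact: vnorm_ge0.
- exact: sqrtr_ge0.
rewrite sqr_sqrtr; last by rewrite addr_ge0// mulr_ge0.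
apply: le_trans (rosenthal_moment k (lexx _)); apply: ge0_le_integral => //.
- by move=> w _; rewrite lee_fin powR_ge0.
- apply/measurable_EFinP; apply: (measurableT_comp (@measurable_powR R (p / 2))).
  exact: measurable_sqr_vnorm.
- apply/measurable_EFinP; apply: (measurableT_comp (@measurable_powR R (p / 2))).
  by apply: measurable_funD => //; exact: measurable_sqr_vnorm.
- move=> w _; rewrite lee_fin; apply: ler_powRl; rewrite ?sqr_ge0 ?lerDr//.
  by rewrite divr_ge0.
Qed.

End Rosenthal.

(** * Comparison of the collected constants with the stated ones *)

Section FinalBound.
Context {R : realType}.
Implicit Types x y z : R.

Lemma sqrtr_le_sqr x y : 0 <= y -> x <= y ^+ 2 -> Num.sqrt x <= y.
Proof. by move=> y0 xy; rewrite -(ger0_norm y0) -sqrtr_sqr ler_wsqrtr. Qed.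

Lemma powR_half_sqr x y : 0 <= y -> x = y ^+ 2 -> x `^ (1 / 2) = y.
Proof. by move=> y0 ->; rewrite powR_square// powRr1. Qed.

Lemma pos_sqr x : 0 < x -> exists2 y, 0 < y & x = y ^+ 2.
Proof. by move=> x0; exists (Num.sqrt x); rewrite ?sqrtr_gt0// sqr_sqrtr// ltW. Qed.

(** Pure scalar bookkeeping. Every positive parameter is replaced by the square of its root, which
    turns the half powers into monomials that [field] and [lra] can handle. *)
Lemma sum_bound_le p alpha a kappa CA E K s2 X0 ex trB flB SB MB (m : nat) :
  (0 < m)%N -> 2 <= p -> 0 < alpha -> 0 < a -> 0 < kappa -> 0 <= CA -> 0 <= E ->
  0 <= K -> 2 * K <= p ^+ 2 -> 0 <= s2 -> 0 <= X0 -> 0 <= ex ->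
  trB = Num.sqrt kappa * (ex * X0) ->
  flB = Num.sqrt (4 * kappa * alpha * p * E ^+ 2 / a) ->
  SB = Num.sqrt (p ^+ 2 * E ^+ 2 + m%:R * ((1 + 16 * p) * s2)) ->
  MB = Num.sqrt (K * CA ^+ 2 * (m%:R * (4 * kappa * alpha * p * E ^+ 2 / a))) ->
  (m.*2%:R / 2) `^ (1 / 2) * ((alpha * m%:R)^-1 * (trB + trB + (flB + flB)) +
     m%:R^-1 * (SB + MB + CA * (m%:R * trB))) <=
  C_Rm1 R * Num.sqrt s2 * p `^ (1 / 2) + Delta_fl kappa a CA m.*2 p alpha * E +
  ex * Delta_tr kappa CA m.*2 p alpha * X0.
Proof.
move=> m_gt0 p2 /pos_sqr[sal sal0 ->] /pos_sqr[sa sa0 ->] /pos_sqr[sk sk0 ->].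
move=> CA0 E0 K0 Kp s20 X00 ex0 trBE flBE SBE MBE.
rewrite /Delta_fl /Delta_tr.
have p0 : 0 < p by lra.
move: p0 p2 Kp flBE SBE MBE => /pos_sqr[sp sp0 ->] p2 Kp flBE SBE MBE.
have : 0 < m%:R :> R by rewrite ltr0n.
have -> : m.*2%:R = 2 * m%:R :> R by rewrite -mul2n natrM.
move: SBE MBE; move: (m%:R : R) => mm SBE MBE.
move=> m0; move: m0 SBE MBE => /pos_sqr[sm sm0 ->] SBE MBE.
have two : 0 < 2 :> R by [].
have [st st0 stE] := pos_sqr two.
have eP : 1 <= expR (1 / sp ^+ 2).
  have := expR_ge1Dx (1 / sp ^+ 2); have : 0 <= 1 / sp ^+ 2 by rewrite divr_ge0 ?sqr_ge0.
  lra.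
rewrite sqrtr_sqr (gtr0_norm sk0) in trBE.
have flBle : flB <= 2 * sk * sal * sp * E / sa.
  rewrite flBE; apply: sqrtr_le_sqr; first by rewrite !mulr_ge0 ?invr_ge0// ltW.
  by rewrite le_eqVlt; apply/orP; left; apply/eqP; field; lra.
(* The 5 comes from [1 + 16 * p <= 25 * p]. *)
have SBle : SB <= sp ^+ 2 * E + 5 * sm * sp * Num.sqrt s2.
  have ss0 := sqrtr_ge0 s2.
  rewrite SBE; apply: sqrtr_le_sqr; first by rewrite addr_ge0 ?mulr_ge0 ?sqr_ge0// ltW.
  rewrite -[in X in X <= _](sqr_sqrtr s20); set ss := Num.sqrt s2 in ss0 *.
  have h1 : 0 <= sp ^+ 2 * E * (sm * sp * ss) by rewrite !mulr_ge0 ?sqr_ge0// ltW.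
  have h2 : 0 <= sm ^+ 2 * ss ^+ 2 * (sp ^+ 2 - 1).
    by rewrite !mulr_ge0 ?sqr_ge0//; lra.
  have h3 : 0 <= sm ^+ 2 * ss ^+ 2 by rewrite mulr_ge0 ?sqr_ge0.
  lra.
(* By [2 * K <= p ^+ 2], the product [4 * K * p] is at most [2 * p ^+ 3], whose root is the [D1]
   scale. *)
have MBle : MB <= st * sk * sp ^+ 3 * sal * CA * sm * E / sa.
  rewrite MBE; apply: sqrtr_le_sqr; first by rewrite !mulr_ge0 ?invr_ge0 ?exprn_ge0// ltW.
  have -> : (st * sk * sp ^+ 3 * sal * CA * sm * E / sa) ^+ 2 =
     (sp ^+ 2) ^+ 2 * (CA ^+ 2 * (sm ^+ 2 * (st ^+ 2 * sk ^+ 2 * sal ^+ 2 * sp ^+ 2 * E ^+ 2 / sa ^+ 2))).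
    by field; lra.
  have -> : K * CA ^+ 2 * (sm ^+ 2 * (4 * sk ^+ 2 * sal ^+ 2 * sp ^+ 2 * E ^+ 2 / sa ^+ 2)) =
    (2 * K) * (CA ^+ 2 * (sm ^+ 2 * (2 * sk ^+ 2 * sal ^+ 2 * sp ^+ 2 * E ^+ 2 / sa ^+ 2))).
    by field; lra.
  by rewrite -stE; apply: ler_wpM2r => //; nonneg.
rewrite (@powR_half_sqr _ sm (ltW sm0)); last by field.
rewrite (@powR_half_sqr (sp ^+ 2) sp (ltW sp0))//.
have pow3 : (sp ^+ 2) `^ (3 / 2) = sp ^+ 3.
  by rewrite powR_square ?(ltW sp0)// powR_mulrn// ltW.
rewrite /D1 /D2 /C_Rm1 /C_Rm2 pow3.
rewrite (@powR_half_sqr (2 * sk ^+ 2) (st * sk)); first last.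
- by rewrite exprMn -stE.
- by rewrite mulr_ge0// ltW.
rewrite (@powR_half_sqr (sk ^+ 2) sk (ltW sk0))//.
rewrite (@powR_half_sqr (sa ^+ 2 * sp ^+ 2) (sa * sp)); first last.
- by rewrite exprMn.
- by rewrite mulr_ge0// ltW.
rewrite (@powR_half_sqr (sal ^+ 2 * (2 * sm ^+ 2)) (sal * (st * sm))); first last.
- by rewrite !exprMn -stE.
- by rewrite !mulr_ge0// ltW.
rewrite (@powR_half_sqr (2 * sm ^+ 2) (st * sm)); first last.
- by rewrite !exprMn -stE.
- by rewrite !mulr_ge0// ltW.
rewrite (@powR_half_sqr (sal ^+ 2 * sa ^+ 2) (sal * sa)); first last.
- by rewrite exprMn.
- by rewrite mulr_ge0// ltW.
rewrite powRN (@powR_half_sqr 2 st (ltW st0))//.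
have -> : Num.sqrt (2 * sk ^+ 2) = st * sk.
  by rewrite stE -exprMn sqrtr_sqr gtr0_norm// mulr_gt0.
have pow5 := powR_ge0 (sp ^+ 2) (5 / 2).
move: ((sp ^+ 2) `^ (5 / 2)) pow5 => sp5 pow5.
have e1 : 1 <= expR 1 :> R by rewrite ltW// expR_gt1.
have ss0 := sqrtr_ge0 s2.
move: (Num.sqrt s2) ss0 SBle => ss ss0 SBle.
have d30 : 0 <= D3 (sk ^+ 2) (sa ^+ 2) CA.
  by rewrite /D3; nonneg.
have d40 : 0 <= D4 (sk ^+ 2) (sa ^+ 2) CA.
  have := powR_ge0 (sk ^+ 2) (1 / 2); move: d30 => d30 ?; rewrite /D4; nonneg.
have st2 : st <= 2 by rewrite -(@ler_pXn2r _ 2) ?nnegrE ?(ltW st0)// -stE; lra.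
have st1 : 1 <= st by rewrite -(@ler_pXn2r _ 2) ?nnegrE ?(ltW st0)// -stE; lra.
set d3 := D3 _ _ _ in d30 *; set d4 := D4 _ _ _ in d40 *.
move: (expR (1 / sp ^+ 2)) eP => eP eP1; move: (expR 1) e1 => e e1.
have [sal' sa' sk' sp' sm'] : [/\ 0 <= sal, 0 <= sa, 0 <= sk, 0 <= sp & 0 <= sm].
  by split; exact: ltW.
(* T1 and T2 are the boundary terms of [tr] and [fl], T3 and T4 the sup-norm and variance parts of
   the i.i.d. sum, T5 the martingale, T6 the transient remainder. *)
pose T1 := 2 * sk * (ex * X0) / (sal ^+ 2 * sm).
pose T2 := 4 * sk * sp * E / (sa * sal * sm).
pose T3 := sp ^+ 2 * E / sm.
pose T4 := 5 * sp * ss.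
pose T5 := st * sk * sp ^+ 3 * sal * CA * E / sa.
pose T6 := CA * sm * sk * (ex * X0).
have T10 : 0 <= T1 by rewrite /T1; nonneg.
have T20 : 0 <= T2 by rewrite /T2; nonneg.
have T30 : 0 <= T3 by rewrite /T3; nonneg.
have T60 : 0 <= T6 by rewrite /T6; nonneg.
apply: (@le_trans _ _ (T1 + T2 + T3 + T4 + T5 + T6)).
  pose flB' := 2 * sk * sal * sp * E / sa.
  pose SB' := sp ^+ 2 * E + 5 * sm * sp * ss.
  pose MB' := st * sk * sp ^+ 3 * sal * CA * sm * E / sa.
  apply: (@le_trans _ _ (sm * ((sal ^+ 2 * sm ^+ 2)^-1 * (trB + trB + (flB' + flB')) +
     (sm ^+ 2)^-1 * (SB' + MB' + CA * (sm ^+ 2 * trB))))).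
    rewrite ler_wpM2l// lerD//; rewrite ler_wpM2l ?invr_ge0//; try by nonneg.
      by rewrite lerD2l lerD.
    by rewrite lerD2r lerD.
  rewrite le_eqVlt; apply/orP; left; apply/eqP.
  rewrite trBE /flB' /SB' /MB' /T1 /T2 /T3 /T4 /T5 /T6; field.
  by rewrite !gt_eqF.
have F0 : T4 <= 60 * e * ss * sp.
  rewrite /T4; have : 0 <= (60 * e - 5) * (ss * sp) by rewrite mulr_ge0 ?mulr_ge0//; lra.
  by lra.
have F1 : T2 <= 4 * eP * (st * sk / sa ^+ 2 * (1 + 4 * sk * CA / sa ^+ 2)) *
    (sa * sp) / (sal * (st * sm)) * E.
  have -> : 4 * eP * (st * sk / sa ^+ 2 * (1 + 4 * sk * CA / sa ^+ 2)) *
    (sa * sp) / (sal * (st * sm)) * E = T2 * (eP * (1 + 4 * sk * CA / sa ^+ 2)).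
    by rewrite /T2; field; rewrite !gt_eqF.
  rewrite ler_peMr// -[leLHS]mulr1 ler_pM//.
  by rewrite lerDl; nonneg.
have F2 : 0 <= eP * CA * (d3 + d4) * sal ^+ 2 * sa ^+ 2 * sp5 * E.
  have : 0 <= eP by lra.
  by move=> ?; nonneg.
have F3 : T3 <= 2 * 60 * sp ^+ 2 / (st * sm) * E.
  have -> : 2 * 60 * sp ^+ 2 / (st * sm) * E = T3 * (120 / st).
    by rewrite /T3; field; rewrite !gt_eqF.
  by rewrite ler_peMr// ler_pdivlMr//; lra.
have F4 : T5 = CA * (st * sk / sa ^+ 2) * (sal * sa) * sp ^+ 3 * E.
  by rewrite /T5; field; rewrite !gt_eqF.
have F5 : T1 + T6 <= ex * (eP * sk * (4 / (sal ^+ 2 * (st * sm)) + st^-1 * (st * sm) * CA)) * X0.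
  have -> : ex * (eP * sk * (4 / (sal ^+ 2 * (st * sm)) + st^-1 * (st * sm) * CA)) * X0 =
     eP * (T1 * (2 / st) + T6) by rewrite /T1 /T6; field; rewrite !gt_eqF.
  have : T1 <= T1 * (2 / st) by rewrite ler_peMr// ler_pdivlMr//; lra.
  set T1' := T1 * _ => h.
  have : T1' + T6 <= eP * (T1' + T6) by rewrite ler_peMl// addr_ge0//; lra.
  by lra.
by clearbody T1 T2 T3 T4 T5 T6; rewrite !(mulrDl _ _ E); lra.
Qed.

End FinalBound.

(** * Consequences of the Lyapunov equation *)

Section Lyapunov.
Context {R : realType} {d : nat}.
Implicit Types (Q B : 'M[R]_d) (x : 'cV[R]_d).

Lemma lyapunov_form Q B x : B^T *m Q + Q *m B = 1%:M ->
  form Q (B *m x) x + form Q x (B *m x) = vnorm x ^+ 2.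
Proof.
move=> lyap; rewrite sqr_vnorm -lyap /form trmx_mul mulmxDr mulmxDl [RHS]mxE.
by rewrite !mulmxA.
Qed.

Lemma lyapunov_unit Q B : B^T *m Q + Q *m B = 1%:M -> B \in unitmx.
Proof.
move=> lyap; rewrite -unitmx_tr -row_free_unit -kermx_eq0; apply/rowV0P => v.
move=> /sub_kermxP vB; have Bv : B *m v^T = 0 by rewrite -[B]trmxK -trmx_mul vB trmx0.
have := lyapunov_form v^T lyap; rewrite Bv {1}/form trmx0 !mul0mx mxE.
rewrite /form mulmx0 mxE addr0 => /esym/eqP; rewrite sqrf_eq0 => /eqP/vnorm_eq0 h.
by rewrite -[v]trmxK h trmx0.
Qed.

Lemma entry_le_opnorm B i j : `|B i j| <= opnorm B.
Proof.
have -> : B i j = (B *m (delta_mx j 0 : 'cV[R]_d)) i 0.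
  rewrite mxE (bigD1 j)//= mxE !eqxx mulr1 big1 ?addr0// => k kj.
  by rewrite mxE (negbTE kj) mulr0.
apply: (le_trans (normr_coord_le _ _)); apply: (le_trans (vnorm_mulmx_le _ _)).
have -> : vnorm (delta_mx j 0 : 'cV[R]_d) = 1.
  rewrite /vnorm (bigD1 j)//= mxE !eqxx expr1n big1 ?addr0 ?sqrtr1// => k kj.
  by rewrite mxE (negbTE kj) expr0n.
by rewrite mulr1.
Qed.

Hypothesis d_gt0 : (0 < d)%N.

Lemma opnorm_gt0_posdef Q : posdef_mx Q -> 0 < opnorm Q.
Proof.
move=> Q0; have [u u1] := unit_vector d_gt0 (R := R).
have un0 : u != 0.
  by apply/eqP => u0; move: u1; rewrite u0 vnorm0 => /eqP; rewrite eq_sym oner_eq0.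
have := form_le_opnorm Q u; rewrite u1 expr1n mulr1; apply: lt_le_trans.
exact: Q0.
Qed.

(** The cross terms sum to [- alpha * vnorm x ^+ 2], at most [- alpha / opnorm Q] times the
    Q-energy; the step-size bound limits the quadratic term to half of that gain, and the other half
    is the rate. *)
Lemma lyapunov_contraction Q B (alpha : R) x :
  symmetric_mx Q -> posdef_mx Q -> B^T *m Q + Q *m B = 1%:M -> 0 <= alpha ->
  alpha * (2 * Qopnorm Q B ^+ 2 * opnorm Q) <= 1 ->
  form Q (x - alpha *: (B *m x)) (x - alpha *: (B *m x)) <=
  (1 - alpha * (1 / (2 * opnorm Q))) * form Q x x.
Proof.
move=> QT Q0 lyap al0 al1.
have N0 := opnorm_gt0_posdef Q0; set N := opnorm Q in N0 al1 *.
have l := lyapunov_form x lyap.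
have q0 := form_ge0_posdef Q0 x.
have h1 : form Q (B *m x) (B *m x) <= Qopnorm Q B ^+ 2 * form Q x x.
  rewrite -(sqr_Qnorm (form_ge0_posdef Q0 (B *m x))) -(sqr_Qnorm q0) -exprMn.
  have h := Qnorm_mulmx_le d_gt0 B x QT Q0.
  by rewrite ler_pXn2r ?nnegrE ?Qnorm_ge0 ?(le_trans _ h) ?Qnorm_ge0.
have h2 : form Q x x <= N * vnorm x ^+ 2 := form_le_opnorm Q x.
have h3 : alpha ^+ 2 * form Q (B *m x) (B *m x) <= alpha / (2 * N) * form Q x x.
  apply: (@le_trans _ _ (alpha ^+ 2 * (Qopnorm Q B ^+ 2 * form Q x x))).
    by rewrite ler_wpM2l ?sqr_ge0.
  rewrite mulrA ler_wpM2r// ler_pdivlMr ?mulr_gt0//.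
  have := ler_wpM2l al0 al1; lra.
have h4 : alpha / N * form Q x x <= alpha * vnorm x ^+ 2.
  rewrite -mulrA ler_wpM2l// mulrC ler_pdivrMr// mulrC; exact: h2.
rewrite !(formDl, formDr, formNl, formNr, formZl, formZr).
have h5 : alpha * (1 / (2 * N)) * form Q x x = alpha / N * form Q x x - alpha / (2 * N) * form Q x x.
  by field; rewrite gt_eqF.
have l2 : alpha * (form Q (B *m x) x + form Q x (B *m x)) = alpha * vnorm x ^+ 2 by rewrite l.
clear lyap; lra.
Qed.

End Lyapunov.

(** * Shifted samples and bounded integrands *)

Section Shift.
Context {R : realType} {dZ dO : measure_display}.
Context {Zt : measurableType dZ} {Om : measurableType dO}.
Variables (pi : probability Zt R) (P : probability Om R) (Z : nat -> Om -> Zt).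

(** Lets the noise sum over the averaging window be read as a [fresh_sum] started at 0. *)
Lemma iid_shift m : iid_seq pi P Z -> iid_seq pi P (fun k => Z (m + k)%N).
Proof.
move=> [mZ [lawZ indepZ]]; split; first by move=> k k0; apply: mZ; lia.
split; first by move=> k k0; apply: lawZ; lia.
move=> I uI /allP posI B mB.
have uI' : uniq [seq (m + i)%N | i <- I] by rewrite map_inj_uniq//; exact: addnI.
have posI' : all (fun k => 0 < k)%N [seq (m + i)%N | i <- I].
  by apply/allP => _ /mapP[k kI ->]; have := posI _ kI; lia.
have := indepZ _ uI' posI' (fun j => B (j - m)%N) (fun j => mB _).
rewrite big_map; under eq_bigr do rewrite addKn.
move=> <-; congr (P _); apply/seteqP; split => w h k /=.
  by move=> /mapP[i iI ->]; rewrite /preimage /= addKn; exact: h.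
by move=> kI; have := h (m + k)%N (map_f _ kI); rewrite /preimage /= addKn.
Qed.

End Shift.

Section Bounded.
Context {R : realType} {dZ : measure_display} {Zt : measurableType dZ}.
Variable pi : probability Zt R.

Lemma bounded_integrable (c : Zt -> R) (C : R) : measurable_fun setT c ->
  (forall z, `|c z| <= C) -> pi.-integrable setT (EFin \o c).
Proof.
move=> mc cC; apply: (@le_integrable _ _ _ pi setT _ _ (EFin \o cst C)) => //.
- exact/measurable_EFinP.
- by move=> z _ /=; rewrite lee_fin (le_trans (cC z))// ler_norm.
- exact: finite_measure_integrable_cst.
Qed.

Lemma cov_mean_trace d (e : Zt -> 'cV[R]_d) (M : R) : vmeasurable e ->
  (forall z, vnorm (e z) <= M) ->
  centered pi (fun z => vnorm (e z) ^+ 2 - \tr (cov_mean pi e)) /\ 0 <= \tr (cov_mean pi e).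
Proof.
move=> me eM; split; last first.
  rewrite /mxtrace sumr_ge0// => i _; rewrite mxE fine_ge0// integral_ge0// => z _.
  by rewrite lee_fin -expr2 sqr_ge0.
apply: (@eq_centered _ _ _ _ (fun z => \sum_i (e z i 0 * e z i 0 - \int[pi]_z (e z i 0 * e z i 0)))).
  move=> z; rewrite sqr_vnorm dot_sum /mxtrace -sumrB.
  by apply: eq_bigr => i _; rewrite mxE.
apply: centered_sum => i; apply: (@centered_sub_mean _ _ _ _ (fun z => e z i 0 * e z i 0)).
apply: (@bounded_integrable _ (M * M)); first exact: measurable_funM.
move=> z; rewrite normrM; have := le_trans (normr_coord_le (e z) i) (eM z).
by move=> h; rewrite ler_pM.
Qed.

End Bounded.

(** * Algebraic decomposition of the averaged error *)

Section Decomposition.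
Context {R : realType} {dZ : measure_display} {Zt : measurableType dZ} {Om : Type} {d : nat}.
Variables (A : Zt -> 'M[R]_d) (b eps : Zt -> 'cV[R]_d) (Abar : 'M[R]_d).
Variables (Z : nat -> Om -> Zt) (alpha : R) (th0 thstar : 'cV[R]_d).
Hypothesis epsE : forall z, eps z = A z *m thstar - b z.
(** Both parts are instances of [lsa], so the same moment bounds cover them. The forcing of [fl] is
    [- eps] because the error recursion subtracts [alpha *: eps], while [lsa] adds [alpha] times its
    forcing. *)
Let tr := lsa A (fun=> 0) Z alpha (th0 - thstar).
Let fl := lsa A (fun z => - eps z) Z alpha 0.
Let th := lsa A b Z alpha th0.

Lemma lsa_split k w : th k w - thstar = tr k w + fl k w.
Proof.
elim: k => [|k IH]; first by rewrite /th /tr /fl /= addr0.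
have thE : th k w = tr k w + fl k w + thstar by rewrite -IH subrK.
rewrite /th /tr /fl /= -/th -/tr -/fl -/(th k w) -/(tr k w) -/(fl k w) thE epsE.
rewrite !mulmxDr !scalerBr !scalerDr scaler0 !scalerN.
set u1 := alpha *: _; set u2 := alpha *: _; set u3 := alpha *: _; set u4 := alpha *: _.
by apply/colP => i; rewrite !mxE; ring.
Qed.

(** Solve one step of the error recursion for [Abar *m (th k w - thstar)]: the differences of
    consecutive errors telescope over the window, and the rest is the noise. *)
Lemma averaged_identity m w : 0 < alpha -> (0 < m)%N ->
  Abar *m (pr_avg A b Z alpha th0 m.*2 w - thstar) =
  (alpha * m%:R)^-1 *: (tr m w + fl m w - (tr m.*2 w + fl m.*2 w)) -
  m%:R^-1 *: ((\sum_(m <= k < m.*2) (A (Z k.+1 w) - Abar) *m fl k w)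
   + (\sum_(m <= k < m.*2) (A (Z k.+1 w) - Abar) *m tr k w)
   + \sum_(m <= k < m.*2) eps (Z k.+1 w)).
Proof.
move=> al0 m0.
have mn0 : m%:R != 0 :> R by rewrite pnatr_eq0 -lt0n.
have aln0 : alpha != 0 by rewrite gt_eqF.
have step k : Abar *m (th k w - thstar) =
    alpha^-1 *: ((tr k w + fl k w) - (tr k.+1 w + fl k.+1 w))
    - ((A (Z k.+1 w) - Abar) *m fl k w + (A (Z k.+1 w) - Abar) *m tr k w + eps (Z k.+1 w)).
  rewrite lsa_split; have -> : tr k.+1 w + fl k.+1 w =
     tr k w + fl k w - alpha *: (A (Z k.+1 w) *m (tr k w + fl k w) + eps (Z k.+1 w)).
    rewrite /tr /fl /= -/(tr k w) -/(fl k w) opprK subr0 mulmxDr !scalerDr.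
    by rewrite opprD [LHS]addrACA -!addrA -?opprD; congr (_ + (_ + _)); rewrite !opprD !addrA.
  rewrite subKr scalerA mulVf// scale1r !mulmxBl !mulmxDr.
  set a1 := _ *m _; set a2 := _ *m _; set a3 := _ *m _; set a4 := _ *m _.
  by apply/colP => i; rewrite !mxE; ring.
have -> : pr_avg A b Z alpha th0 m.*2 w - thstar =
    m%:R^-1 *: \sum_(m <= k < m.*2) (th k w - thstar).
  rewrite sumrB scalerBr /pr_avg doubleK -mul2n natrM; congr (_ *: _ - _).
    by field.
  rewrite sumr_const_nat mul2n -addnn addnK -[thstar *+ m]scaler_nat scalerA mulVf//.
  by rewrite scale1r.
rewrite -scalemxAr mulmx_sumr; under eq_bigr do rewrite step.
rewrite sumrB scalerBr -scaler_sumr scalerA -invfM [m%:R * alpha]mulrC.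
congr (_ *: _ - _ *: _); last by rewrite !big_split.
have := telescope_sumr (fun k => - (tr k w + fl k w)) (leq_addr m m).
rewrite addnn opprK [RHS]addrC => <-.
by apply: eq_bigr => k _; rewrite opprK addrC.
Qed.

Lemma averaged_norm_le (CA : R) m w : 0 < alpha -> (0 < m)%N ->
  (forall z x, vnorm ((A z - Abar) *m x) <= CA * vnorm x) ->
  vnorm (Abar *m (pr_avg A b Z alpha th0 m.*2 w - thstar)) <=
  (alpha * m%:R)^-1 * (vnorm (tr m w) + vnorm (tr m.*2 w) + (vnorm (fl m w) + vnorm (fl m.*2 w))) +
  m%:R^-1 * (vnorm (\sum_(m <= k < m.*2) eps (Z k.+1 w)) +
    vnorm (\sum_(m <= k < m.*2) (A (Z k.+1 w) - Abar) *m fl k w) +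
    CA * \sum_(m <= k < m.*2) vnorm (tr k w)).
Proof.
move=> al0 m0 At_le; rewrite averaged_identity//.
apply: (le_trans (vnormD _ _)); rewrite vnormN !vnormZ !ger0_norm ?invr_ge0 ?mulr_ge0 ?(ltW al0)//.
rewrite lerD// ler_wpM2l ?invr_ge0 ?mulr_ge0 ?(ltW al0)//.
  have h1 := vnormD (tr m w + fl m w) (- (tr m.*2 w + fl m.*2 w)).
  have h2 := vnormD (tr m w) (fl m w); have h3 := vnormD (tr m.*2 w) (fl m.*2 w).
  by rewrite vnormN in h1; lra.
set s1 := \sum_(_ <= _ < _) _; set s2 := \sum_(_ <= _ < _) _; set s3 := \sum_(_ <= _ < _) _.
have h1 := vnormD (s1 + s2) s3; have h2 := vnormD s1 s2.
suff : vnorm s2 <= CA * \sum_(m <= k < m.*2) vnorm (tr k w) by lra.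
apply: (le_trans (vnorm_sum _ _)); rewrite mulr_sumr; apply: ler_sum => k _; exact: At_le.
Qed.

End Decomposition.

(** * Step-size conditions and decay rates *)

Section Rates.
Context {R : realType}.

(** Covers D = 0, where [y / D] is 0 by convention, so the denominators of the step-size bounds need
    not be shown positive. *)
Lemma mulr_le_of_lt_div (x y D : R) : 0 <= y -> 0 <= D -> x < y / D -> x * D <= y.
Proof.
move=> y0 D0; have [->|Dn0] := eqVneq D 0; first by rewrite mulr0.
have Dgt0 : 0 < D by rewrite lt_def Dn0.
by rewrite ltr_pdivlMr// => /ltW.
Qed.

Lemma contraction_rate_bounds (alpha a kappa CA K p : R) : 0 < alpha -> 0 < a ->
  0 < kappa -> 0 <= K -> K <= 4 / 3 * p -> 8 * kappa * CA ^+ 2 * p * alpha <= a ->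
  alpha * a <= 1 / 2 ->
  0 <= 1 - alpha * a + 2 * K * alpha ^+ 2 * kappa * CA ^+ 2 <= 1 - 2 / 3 * (alpha * a).
Proof.
move=> al0 a0 k0 K0 Kp h ala.
have w0 : 0 <= alpha ^+ 2 * kappa * CA ^+ 2 by nonneg.
have h1 := ler_wpM2r w0 Kp; have h2 := ler_wpM2l (ltW al0) h.
have h3 := mulr_ge0 K0 w0.
by apply/andP; split; lra.
Qed.

(** Each factor is at most [expR (- (x / 2))], and m of them give the square of the stated
    exponential. The square appears because rho governs squared norms. *)
Lemma geometric_le_expR (rho x : R) (m k : nat) : 0 <= rho -> rho <= 1 - 2 / 3 * x ->
  0 <= x -> (m <= k)%N -> rho ^+ k <= expR (- (x * m.*2%:R / 8)) ^+ 2.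
Proof.
move=> rho0 rhox x0 mk.
have rho1 : rho <= 1 by lra.
apply: (@le_trans _ _ (rho ^+ m)); first by rewrite -(subnK mk) exprD ler_piMl ?exprn_ge0// exprn_ile1.
have -> : expR (- (x * m.*2%:R / 8)) ^+ 2 = expR (- (x / 2)) ^+ m.
  rewrite -!expRM_natr -mul2n natrM; congr expR; by field.
apply: lerXn2r; rewrite ?nnegrE ?expR_ge0//.
by have := expR_ge1Dx (- (x / 2)); lra.
Qed.

End Rates.

Theorem theorem2 (R : realType) (d : nat)
  (dZ : measure_display) (Zt : measurableType dZ) (pi : probability Zt R)
  (A : Zt -> 'M[R]_d) (b : Zt -> 'cV[R]_d)
  (dO : measure_display) (Om : measurableType dO) (P : probability Om R)
  (Z : nat -> Om -> Zt) (Q : 'M[R]_d)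
  (p : R) (n : nat) (alpha : R) (th0 : 'cV[R]_d) :
  (0 < d)%N ->
  (* measurability / integrability of the data *)
  (forall i j, measurable_fun setT (fun z => A z i j)) ->
  (forall i, measurable_fun setT (fun z => b z i 0)) ->
  (forall i, pi.-integrable setT (fun z => (b z i 0)%:E)) ->
  let Abar := mat_mean pi A in
  let bbar := vec_mean pi b in
  (* -Abar is Hurwitz *)
  neg_hurwitz Abar ->
  (* C_A < oo *)
  (exists M : R, forall z, opnorm (A z) <= M /\ opnorm (A z - Abar) <= M) ->
  let CA := Order.max (sup (range (fun z => opnorm (A z))))
                      (sup (range (fun z => opnorm (A z - Abar)))) in
  let thstar := invmx Abar *m bbar in
  let eps := fun z => (A z - Abar) *m thstar - (b z - bbar) in
  (* ||eps||_oo < oo *)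
  (exists M : R, forall z, vnorm (eps z) <= M) ->
  let eps_inf := sup (range (fun z => vnorm (eps z))) in
  let Sigma := cov_mean pi eps in
  (* Q: the symmetric positive definite solution of the Lyapunov equation *)
  symmetric_mx Q -> posdef_mx Q -> Abar^T *m Q + Q *m Abar = 1%:M ->
  let kappa := kappaQ Q in
  let a := 1 / (2 * opnorm Q) in
  let alpha_inf := Order.min (1 / (2 * Qopnorm Q Abar ^+ 2 * opnorm Q)) (opnorm Q) in
  let bQ := 2 * Num.sqrt kappa * CA in
  let alpha_q := fun q : R => Order.min alpha_inf (a / (2 * bQ ^+ 2 * q)) in
  (* i.i.d. sample Z_1, Z_2, ... with law pi *)
  iid_seq pi P Z ->
  2 <= p -> (2 <= n)%N -> ~~ odd n ->
  0 < alpha -> alpha < alpha_q (p * (1 + ln d%:R)) ->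
  let f := fun w => vnorm (Abar *m (pr_avg A b Z alpha th0 n w - thstar)) in
  (((n%:R / 2) `^ (1/2))%:E * Lnorm P p%:E (EFin \o f) <=
   (C_Rm1 R * Num.sqrt (\tr Sigma) * p `^ (1/2)
    + Delta_fl kappa a CA n p alpha * eps_inf
    + expR (- (alpha * a * n%:R / 8)) * Delta_tr kappa CA n p alpha
      * vnorm (th0 - thstar))%:E)%E.
Proof.
move=> d0 mA mb ib Abar bbar _ [MA HMA] CA thstar eps [ME HME] eps_inf Sigma QT Q0 lyap
  kappa a alpha_inf bQ alpha_q iid p2 n2 nodd al0 alq; cbv zeta.
set f := (X in EFin \o X).
have nE : n = (n./2).*2 by rewrite even_halfK.
have m0 : (0 < n./2)%N by move: n2; rewrite nE; case: (n./2).
move: (n./2) nE m0 => m nE m0; subst n.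
have [K [K0 Kp Kp2 twoK]] := two_point p2.
have p0 : 0 < p by rewrite (lt_le_trans _ p2).
have N0 : 0 < opnorm Q := opnorm_gt0_posdef d0 Q0.
have l0 : 0 < lambda_min Q := lambda_min_gt0 d0 QT Q0.
have L0 : 0 < lambda_max Q := lt_le_trans l0 (lambda_min_le_max d0 QT).
have [_ le_lmin] := lambda_min_eigenvalue d0 QT.
have [_ le_lmax] := lambda_max_eigenvalue d0 QT.
have k0 : 0 < kappa by rewrite /kappa /kappaQ divr_gt0.
have a0 : 0 < a by rewrite /a divr_gt0// mulr_gt0.
have opA z : opnorm (A z) <= MA by case: (HMA z).
have opAt z : opnorm (A z - Abar) <= CA.
  rewrite /CA le_max; apply/orP; right; apply: ub_le_sup; last by exists z.
  by exists MA => _ [y _ <-]; case: (HMA y).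
(* Measurable types are pointed, so the supremum is over a nonempty set. *)
have CA0 : 0 <= CA by apply: le_trans (opAt point); exact: opnorm_ge0.
have At_le z x : vnorm ((A z - Abar) *m x) <= CA * vnorm x.
  by apply: (le_trans (vnorm_mulmx_le _ _)); rewrite ler_wpM2r ?vnorm_ge0.
have eps_le z : vnorm (eps z) <= eps_inf.
  by apply: ub_le_sup; [exists ME => _ [y _ <-]; exact: HME|exists z].
have E0 : 0 <= eps_inf by apply: le_trans (eps_le point); exact: vnorm_ge0.
have cAt i j : centered pi (fun z => (A z - Abar) i j).
  apply: (@eq_centered _ _ _ _ (fun z => A z i j - \int[pi]_z (A z i j))).
    by move=> z; rewrite !mxE.
  apply: centered_sub_mean; apply: (@bounded_integrable _ _ _ _ _ MA) => // z.
  exact: le_trans (entry_le_opnorm _ _ _) (opA z).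
have cb : vcentered pi (fun z => bbar - b z).
  move=> i; apply: (@eq_centered _ _ _ _ (fun z => -1 * (b z i 0 - \int[pi]_z (b z i 0)))).
    by move=> z; rewrite !mxE mulN1r opprB.
  by apply: centeredZ; exact: (@centered_sub_mean _ _ _ _ (fun z => b z i 0) (ib i)).
have ceps : vcentered pi eps.
  move=> i; apply: (@eq_centered _ _ _ _ (fun z => ((A z - Abar) *m thstar) i 0 + (bbar - b z) i 0)).
    by move=> z; rewrite /eps !mxE; ring.
  by apply: centeredD => //; exact: vcentered_mulmx.
have meps : vmeasurable eps.
  apply: vmeasurableB; last by apply: vmeasurableB => //; exact: vmeasurable_cst.
  apply: vmeasurable_mulmx; last exact: vmeasurable_cst.
  move=> i j; apply: (eq_measurable_fun (fun z => A z i j - Abar i j)).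
    by move=> z _; rewrite !mxE.
  exact: measurable_funB.
have epsE z : eps z = A z *m thstar - b z.
  have Abth : Abar *m thstar = bbar by rewrite /thstar mulKVmx// (lyapunov_unit lyap).
  by rewrite /eps mulmxBl Abth opprB addrA subrK.
have [ce2 s20] := cov_mean_trace pi meps eps_le.
have ln0 : 0 <= ln d%:R :> R by rewrite ln_ge0// ler1n.
have [al_inf al_q] : alpha < alpha_inf /\
    alpha < a / (2 * bQ ^+ 2 * (p * (1 + ln d%:R))).
  by move: alq; rewrite /alpha_q lt_min => /andP.
have [al_Q al_N] : alpha < 1 / (2 * Qopnorm Q Abar ^+ 2 * opnorm Q) /\ alpha < opnorm Q.
  by move: al_inf; rewrite /alpha_inf lt_min => /andP.
have contraction x := @lyapunov_contraction _ _ d0 Q Abar alpha x QT Q0 lyap (ltW al0).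
have {}contraction x := contraction x
  (mulr_le_of_lt_div ler01 (mulr_ge0 (mulr_ge0 (ler0n _ 2) (sqr_ge0 _)) (ltW N0)) al_Q).
have ala : alpha * a <= 1 / 2.
  by rewrite /a mulrA mulr1 ler_pdivrMr ?mulr_gt0//; lra.
have small : 8 * kappa * CA ^+ 2 * p * alpha <= a.
  have bQE : bQ ^+ 2 = 4 * kappa * CA ^+ 2.
    by rewrite /bQ !exprMn sqr_sqrtr ?(ltW k0)//; ring.
  have bq0 : 0 <= bQ ^+ 2 by exact: sqr_ge0.
  have D0 : 0 <= 2 * bQ ^+ 2 * (p * (1 + ln d%:R)).
    by nonneg.
  have := mulr_le_of_lt_div (ltW a0) D0 al_q; apply: le_trans; rewrite bQE in bq0 *.
  have : 0 <= alpha * (2 * (4 * kappa * CA ^+ 2) * (p * ln d%:R)).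
    by nonneg.
  clear lyap; lra.
have /andP[rho0 rho_le] := contraction_rate_bounds al0 a0 k0 K0 Kp small ala.
pose rho := 1 - alpha * a + 2 * K * alpha ^+ 2 * kappa * CA ^+ 2.
have rhoE : rho = 1 - alpha * a + 2 * K * alpha ^+ 2 * (lambda_max Q / lambda_min Q) * CA ^+ 2 by [].
rewrite -/rho in rho0 rho_le.
pose x0 := th0 - thstar.
pose tr := lsa A (fun=> 0) Z alpha x0.
pose fl := lsa A (fun z => - eps z) Z alpha 0.
pose ex := expR (- (alpha * a * m.*2%:R / 8)).
pose trB := Num.sqrt kappa * (ex * vnorm x0).
pose flB := Num.sqrt (4 * kappa * alpha * p * eps_inf ^+ 2 / a).
pose SB := Num.sqrt (p ^+ 2 * eps_inf ^+ 2 + m%:R * ((1 + 16 * p) * \tr Sigma)).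
pose MB := Num.sqrt (K * CA ^+ 2 * (m%:R * (4 * kappa * alpha * p * eps_inf ^+ 2 / a))).
have Q0' := form_ge0_posdef Q0.
have tr_bound k : (m <= k)%N -> Lp_bound P p (fun w => vnorm (tr k w)) trB.
  move=> mk.
  (* Without forcing the additive noise vanishes, so pure geometric decay solves the energy
     recursion. *)
  have u_rec j : rho * (rho ^+ j * form Q x0 x0) + 2 * K * alpha ^+ 2 * lambda_max Q * 0 ^+ 2 <=
      rho ^+ j.+1 * form Q x0 x0 by rewrite expr0n mulr0 addr0 exprS mulrA.
  have c00 : vcentered pi (fun=> 0 : 'cV[R]_d).
    by move=> i; apply: eq_centered (centered0 pi) => z; rewrite mxE.
  have b00 (z : Zt) : vnorm (0 : 'cV[R]_d) <= 0 by rewrite vnorm0.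
  have u00 : form Q x0 x0 <= rho ^+ 0 * form Q x0 x0 by rewrite expr0 mul1r.
  have := Lp_bound_lsa iid mA (vmeasurable_cst 0) cAt c00 At_le b00 CA0 QT Q0' l0 (ltW L0)
    le_lmin le_lmax contraction K0 p2 twoK (u := fun k => rho ^+ k * form Q x0 x0) rho0 u00 u_rec k.
  move=> h; apply: (Lp_bound_le p2 _ _ _ h); [by case: h|by move=> w; rewrite ger0_norm// vnorm_ge0|].
  apply: sqrtr_le_sqr; first by rewrite /trB !mulr_ge0 ?sqrtr_ge0 ?expR_ge0 ?vnorm_ge0.
  rewrite /trB !exprMn sqr_sqrtr ?(ltW k0)//.
  have g := geometric_le_expR rho0 rho_le (mulr_ge0 (ltW al0) (ltW a0)) mk.
  rewrite ler_pdivrMr//.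
  have -> : kappa * (ex ^+ 2 * vnorm x0 ^+ 2) * lambda_min Q = ex ^+ 2 * (lambda_max Q * vnorm x0 ^+ 2).
    by rewrite /kappa /kappaQ; field; rewrite gt_eqF.
  by rewrite ler_pM ?exprn_ge0.
(* A constant supersolution: [alpha * a * U] equals [4 * p * (lambda_max Q * alpha ^+ 2 * eps_inf ^+
   2)], and two thirds of it cover the additive noise precisely because [K <= 4 / 3 * p]. *)
pose U := lambda_min Q * (4 * kappa * alpha * p * eps_inf ^+ 2 / a).
have U0 : 0 <= U by rewrite /U; nonneg.
have u_rec (j : nat) : rho * U + 2 * K * alpha ^+ 2 * lambda_max Q * eps_inf ^+ 2 <= U.
  have UE : U = 4 * lambda_max Q * alpha * p * eps_inf ^+ 2 / a.
    by rewrite /U /kappa /kappaQ; field; rewrite !gt_eqF.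
  have h1 := ler_wpM2r U0 rho_le.
  have h2 : alpha * a * U = 4 * p * (lambda_max Q * alpha ^+ 2 * eps_inf ^+ 2).
    by rewrite UE; field; rewrite gt_eqF.
  have h3 : 0 <= lambda_max Q * alpha ^+ 2 * eps_inf ^+ 2 by nonneg.
  have h4 := ler_wpM2r h3 Kp.
  clear lyap; lra.
have ceps' : vcentered pi (fun z => - eps z).
  by move=> i; apply: eq_centered (centeredZ (-1) (ceps i)) => z; rewrite [RHS]mxE mulN1r.
have meps' : vmeasurable (fun z => - eps z).
  by have := vmeasurableZ (-1) meps; under eq_fun do rewrite scaleN1r.
have eps_le' z : vnorm (- eps z) <= eps_inf by rewrite vnormN.
have u00 : form Q 0 0 <= U by rewrite /form mulmx0 mxE.
have fl_bound k : Lp_bound P p (fun w => vnorm (fl k w)) flB.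
  have := Lp_bound_lsa iid mA meps' cAt ceps' At_le eps_le' CA0 QT Q0' l0 (ltW L0)
    le_lmin le_lmax contraction K0 p2 twoK (u := fun=> U) rho0 u00 u_rec k.
  by rewrite /U mulrAC mulfV ?gt_eqF// mul1r.
(* Indicator weights restrict the martingale to the averaging window while [fl] still runs from time
   0. *)
pose tau (k : nat) : R := (m <= k)%N%:R.
have M_bound : Lp_bound P p (fun w => vnorm (noise_sum Z A Abar fl tau m.*2 w)) MB.
  have := Lp_bound_noise_sum iid mA meps' cAt ceps' At_le eps_le' CA0 QT Q0' l0 (ltW L0)
    le_lmin le_lmax contraction K0 p2 twoK (u := fun=> U) rho0 u00 u_rec tau m.*2.
  rewrite (@big_cat_nat _ _ _ m)//= -?addnn ?leq_addr//.
  rewrite big_nat_cond big1 => [|j /andP[/andP[_ jm] _]]; last first.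
    by rewrite /tau leqNgt jm expr0n mul0r.
  rewrite add0r big_nat_cond (eq_bigr (fun=> U)) => [|j /andP[/andP[jm _] _]]; last first.
    by rewrite /tau jm expr1n mul1r.
  rewrite -big_nat_cond sumr_const_nat addnK -[U *+ m]mulr_natl addnn.
  suff -> : K * CA ^+ 2 / lambda_min Q * (m%:R * U) =
     K * CA ^+ 2 * (m%:R * (4 * kappa * alpha * p * eps_inf ^+ 2 / a)) by [].
  by rewrite /U; field; rewrite !gt_eqF.
have S_bound : Lp_bound P p (fun w => vnorm (fresh_sum (fun k => Z (m + k)%N) eps m w)) SB.
  exact: (Lp_bound_fresh_sum (iid_shift m iid) meps ceps eps_le ce2 p2 s20).
pose Y w := (alpha * m%:R)^-1 * (vnorm (tr m w) + vnorm (tr m.*2 w) + (vnorm (fl m w) + vnorm (fl m.*2 w))) +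
  m%:R^-1 * (vnorm (fresh_sum (fun k => Z (m + k)%N) eps m w) +
    vnorm (noise_sum Z A Abar fl tau m.*2 w) +
    CA * \sum_(0 <= j < m) vnorm (tr (j + m)%N w)).
pose c := (alpha * m%:R)^-1 * (trB + trB + (flB + flB)) +
  m%:R^-1 * (SB + MB + CA * (m%:R * trB)).
have Y_bound : Lp_bound P p Y c.
  have sumE : m%:R * trB = \sum_(0 <= j < m) trB by rewrite sumr_const_nat subn0 mulr_natl.
  rewrite /c sumE; apply: Lp_boundD => //; apply: Lp_boundZ => //.
  - by rewrite invr_ge0 mulr_ge0// ltW.
  - apply: Lp_boundD => //; apply: Lp_boundD => //; apply: tr_bound => //.
    by rewrite -addnn leq_addr.
  - apply: Lp_boundD => //; first exact: Lp_boundD.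
    apply: Lp_boundZ => //; apply: Lp_bound_sum => // j.
    by apply: tr_bound; rewrite leq_addl.
have fY w : f w <= Y w.
  rewrite /f; apply: (le_trans (@averaged_norm_le _ _ _ _ _ A b eps Abar Z alpha th0 thstar epsE
    CA m w al0 m0 At_le)).
  rewrite -/x0 -/tr -/fl /Y.
  have -> : \sum_(m <= k < m.*2) eps (Z k.+1 w) = fresh_sum (fun k => Z (m + k)%N) eps m w.
    rewrite /fresh_sum -{1}[m]add0n big_addn -addnn addnK.
    by apply: eq_bigr => j _; rewrite addnS addnC.
  have -> : \sum_(m <= k < m.*2) (A (Z k.+1 w) - Abar) *m fl k w =
      noise_sum Z A Abar fl tau m.*2 w.
    rewrite /noise_sum [RHS](@big_cat_nat _ _ _ m)//= -?addnn ?leq_addr//.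
    have -> : \sum_(0 <= j < m) tau j *: ((A (Z j.+1 w) - Abar) *m fl j w) = 0.
      by rewrite big_nat big1// => j /andP[_ jm]; rewrite /tau leqNgt jm scale0r.
    rewrite add0r; apply: eq_big_nat => j /andP[jm _].
    by rewrite /tau jm scale1r.
  have -> // : \sum_(m <= k < m.*2) vnorm (tr k w) = \sum_(0 <= j < m) vnorm (tr (j + m)%N w).
  by rewrite -{1}[m]add0n big_addn -addnn addnK.
have mf : measurable_fun setT f.
  apply: measurable_vnorm; apply: vmeasurable_mulmx; first exact: mmeasurable_cst.
  apply: vmeasurableB; last exact: vmeasurable_cst.
  apply: vmeasurableZ; apply: vmeasurable_sum => k i.
  exact (measurable_from_past iid (@lsa_vmeasurable _ _ _ _ _ Z _ A b alpha th0 mA mb k i)).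
have [_ _ f_bound] : Lp_bound P p f c.
  by apply: (Lp_bound_le p2 mf _ (lexx c) Y_bound) => w; rewrite ger0_norm ?vnorm_ge0.
apply: (@le_trans _ _ (((m.*2%:R / 2) `^ (1 / 2))%:E * c%:E)%E).
  by apply: lee_wpmul2l => //; rewrite lee_fin powR_ge0.
rewrite -EFinM lee_fin.
exact: (@sum_bound_le _ p alpha a kappa CA eps_inf K (\tr Sigma) (vnorm x0) ex trB flB SB MB m
  m0 p2 al0 a0 k0 CA0 E0 K0 Kp2 s20 (vnorm_ge0 x0) (expR_ge0 _) erefl erefl erefl erefl).
Qed.
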